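(* The cosmological polytope $\mathcal{C}_{C_n}$ of the $n$-cycle $C_n$ has normalized volume $$\mathrm{Vol}(\mathcal{C}_{C_n})=4^n-2^n.$$
   Context: The $n$-cycle $C_n$ is the graph with vertex set $[n]=\{1,\dots,n\}$ and edge set $\{ii+1 : i\in[n]\}$, where $i+1$ is considered modulo $n$. For an undirected graph $G=(V,E)$, let $x_i$ ($i\in V$) and $x_e$ ($e\in E$) denote the standard basis vectors of $\mathbb{R}^{|V|+|E|}$. The cosmological polytope of $G$ is $$\mathcal{C}_G=\mathrm{conv}\{x_i+x_j-x_e,\ x_i-x_j+x_e,\ -x_i+x_j+x_e ~:~ e=ij\in E\}.$$ It is a lattice polytope of dimension $|V|+|E|-1$. The normalized volume is the volume on the affine span of $\mathcal{C}_G$ scaled so that a unimodular simplex with respect to the lattice $\mathbb{Z}^{|V|+|E|}\cap\mathrm{aff}(\mathcal{C}_G)$ has volume $1$. *)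

(* Defs.v *)
From HB Require Import structures.
From mathcomp Require Import all_boot all_order all_algebra.
From mathcomp Require Import all_classical all_reals all_analysis.

Set Implicit Arguments.
Unset Strict Implicit.
Unset Printing Implicit Defensive.

Import Order.TTheory GRing.Theory Num.Theory.

Local Open Scope classical_set_scope.
Local Open Scope ring_scope.

(* Finite undirected graphs; loops and parallel edges are allowed.  The order
   of the two ends of an edge carries no information: the generators of the
   cosmological polytope below are symmetric in them. *)
Record graph := Graph {
  vertex : finType;
  edge : finType;
  ends : edge -> vertex * vertex
}.

(* Vertices are numbered 0, ..., n-1; edge i joins i and i + 1 mod n.  For
   n = 2 this has two parallel edges and for n = 1 a single loop. *)
Definition cycle_graph (n : nat) : graph :=
  @Graph 'I_n 'I_n (fun i => (i, ordS i)).

Section Hulls.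
Context {R : realType} {E : lmodType R}.

Definition aff_hull (S : set E) : set E :=
  [set x | exists (m : nat) (p : 'I_m -> E) (c : 'I_m -> R),
    [/\ forall i, S (p i), \sum_i c i = 1 & x = \sum_i c i *: p i]].

Definition conv_hull (S : set E) : set E :=
  [set x | exists (m : nat) (p : 'I_m -> E) (c : 'I_m -> R),
    [/\ forall i, S (p i), forall i, 0 <= c i, \sum_i c i = 1
      & x = \sum_i c i *: p i]].

Definition affinely_independent (m : nat) (w : 'I_m -> E) : Prop :=
  forall c : 'I_m -> R, \sum_i c i = 0 -> \sum_i c i *: w i = 0 ->
    forall i, c i = 0.

Definition affine_map (d : nat) (o : E) (b : 'I_d -> E) (t : d.-tuple R) : E :=
  o + \sum_i tnth t i *: b i.

Definition affine_chart (A : set E) (d : nat) (o : E) (b : 'I_d -> E) : Prop :=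
  injective (affine_map o b) /\ range (affine_map o b) = A.

End Hulls.

Section CosmologicalPolytope.
Context (R : realType) (G : graph).

Definition unit_vec (I : finType) (k : I) : {ffun I -> R^o} :=
  [ffun l => (l == k)%:R].

Definition cosmological_generators :
    set {ffun vertex G + edge G -> R^o} :=
  [set y | exists e : edge G,
    let xi := unit_vec (inl (ends e).1) in
    let xj := unit_vec (inl (ends e).2) in
    let xe := unit_vec (inr e) in
    [\/ y = xi + xj - xe, y = xi - xj + xe | y = - xi + xj + xe]].

Definition cosmological_polytope : set {ffun vertex G + edge G -> R^o} :=
  conv_hull cosmological_generators.

End CosmologicalPolytope.

Arguments cosmological_polytope : clear implicits.

(* Lebesgue measure on R^d, as the iterated product of the one on R. *)
Fixpoint lebesgue_tuple (R : realType) (d : nat) :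
    set (d.-tuple (measurableTypeR R)) -> \bar R :=
  match d with
  | 0 => dirac [tuple]
  | d'.+1 =>
      pushforward (@lebesgue_measure R \x @lebesgue_tuple R d')%E
                  (fun p => [tuple of p.1 :: p.2])
  end.

Section NormalizedVolume.
Context {R : realType} {I : finType}.
Local Notation E := {ffun I -> R^o}.

Definition lattice_points : set E := [set x | forall k, x k \is a Num.int].

(* The simplex with vertices w is unimodular with respect to the lattice
   Z^I `&` A: its vertices form an affine basis of that lattice. *)
Definition unimodular (A : set E) (m : nat) (w : 'I_m -> E) : Prop :=
  affinely_independent w /\
  lattice_points `&` A =
    [set x | exists c : 'I_m -> int,
      \sum_i c i = 1 /\ x = \sum_i (c i)%:~R *: w i].

(* Volume on aff P is Lebesgue measure transported by an affine
   parametrization of aff P; it is defined up to a positive factor s, which is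
   fixed by giving volume 1 to a unimodular simplex.  Neither the
   parametrization nor the simplex matters, so v is required for all choices;
   the first conjunct prevents that requirement from being vacuous. *)
Definition is_normalized_volume (P : set E) (v : R) : Prop :=
  (exists (d : nat) (o : E) (b : 'I_d -> E) (w : 'I_d.+1 -> E),
     affine_chart (aff_hull P) o b /\ unimodular (aff_hull P) w) /\
  (forall (d : nat) (o : E) (b : 'I_d -> E) (w : 'I_d.+1 -> E),
     affine_chart (aff_hull P) o b -> unimodular (aff_hull P) w ->
     exists s : R,
       (s%:E * lebesgue_tuple (affine_map o b @^-1` conv_hull (range w))
          = 1%:E)%E /\
       (s%:E * lebesgue_tuple (affine_map o b @^-1` P) = v%:E)%E).

End NormalizedVolume.

(* Main.v *)
Require Import Defs.
From HB Require Import structures.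
From mathcomp Require Import all_boot all_order all_algebra.
From mathcomp Require Import all_classical all_reals all_analysis.
From mathcomp Require Import measurable_realfun.
From mathcomp Require Import ring lra.

(** Let [A_i = x_i + x_(i+1) - e_i], [B_i = x_i - x_(i+1) + e_i] and
    [C_i = - x_i + x_(i+1) + e_i] be the generators that belong to the edge [i],
    where [e_i] is the basis vector of that edge.  For a nonempty set [S] of
    edges, let the cell of [S] be the simplex on all the [C_i], the [A_i] with [i]
    in [S] and the [B_i] with [i] not in [S].  The polytope is the union of these
    [2 ^ n - 1] cells, any two overlap in a null set, and each has normalized
    volume [2 ^ n]; the total is [(2 ^ n - 1) * 2 ^ n = 4 ^ n - 2 ^ n].

    The cells cover the polytope ([polytope_cells]).  A representation of a point
    with weights [a], [b], [c] on the generators is determined by the numbers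
    [p_i = a_i + b_i - c_i], the share of the vertex coordinate [i] carried by
    the edge [i], and nonnegativity of the weights says that [p] solves a system
    of difference constraints.  Such a system has a least solution
    ([feasible_least]).  There, for every [i], one of the two lower bounds on
    [p_i] is attained, that is [a_i = 0] or [b_i = 0], and [b_i = 0] for at least
    one [i]; so the point lies in the cell of the edges with [b_i = 0].
    Conversely these properties determine [p] ([tight_le]): going around the
    cycle, a strict inequality between two such solutions would force all the
    [b_i] to be positive.  Hence a point of two cells has the same weights in
    both, and one of its barycentric coordinates vanishes ([cell_overlap]).

    Since [A_i + C_i = 2 x_(i+1)] and [B_i + C_i = 2 e_i], a cell has the
    determinant of the vectors [C_i] and [x_(i+1)] ([i] in [S]) or [e_i] ([i] not
    in [S]), multiplied by [2 ^ n].  These vectors form a lattice basis, because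
    [S] is nonempty ([half_cell_zspan], [cell_det]).

    The chart and the reference simplex in the definition of normalized volume
    are arbitrary.  Both are handled by comparison with the standard simplex:
    the volume of a simplex in a chart is proportional to the absolute
    determinant of the coordinates of its vertices, with a factor that depends
    on the chart only ([simplex_volume]), and that determinant is 1 for a
    unimodular simplex ([unimodular_det]).  The theorem [triangulated_volume]
    deduces the normalized volume of any polytope triangulated into simplices of
    equal determinant.  The underlying change of variables formula for linear
    maps ([scales_tmulmx]) follows from the one-dimensional one by Tonelli's
    theorem and Gaussian elimination. *)

Set Implicit Arguments.
Unset Strict Implicit.
Unset Printing Implicit Defensive.

Import Order.TTheory GRing.Theory Num.Theory.

Local Open Scope classical_set_scope.
Local Open Scope ring_scope.

(** * Lebesgue measure on tuples as a product measure *)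

Section TupleMeasure.
Context {R : realType}.
Local Notation T := (measurableTypeR R).
Local Notation lam d := (@lebesgue_tuple R d).

Lemma measurable_cons_pair d :
  measurable_fun [set: T * d.-tuple T] (fun p => [tuple of p.1 :: p.2]).
Proof. exact: measurable_cons. Qed.

Lemma measurable_uncons d :
  measurable_fun [set: d.+1.-tuple T] (fun t => (thead t, [tuple of behead t])).
Proof.
apply: measurable_fun_pair; first exact: measurable_tnth.
exact: measurable_behead.
Qed.

Lemma behead_cons_tuple d (x : T) (t : d.-tuple T) :
  [tuple of behead [tuple of x :: t]] = t.
Proof. exact/val_inj. Qed.

(** Product measures and Tonelli's theorem need a sigma-finite second factor, so
    the induction on the dimension carries a bundled sigma-finite measure. *)
Lemma lebesgue_tuple_sigma_finite_measure d :
  exists m : {sigma_finite_measure set (d.-tuple T) -> \bar R}, lam d = m.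
Proof.
elim: d => [|d [m mE]].
  by exists (dirac ([tuple] : 0.-tuple T) : {sigma_finite_measure set _ -> \bar R}).
pose f := fun p : T * d.-tuple T => [tuple of p.1 :: p.2].
have mf : measurable_fun setT f by exact: measurable_cons_pair.
pose pm : {measure set _ -> \bar R} := (@lebesgue_measure R \x m)%E.
unshelve epose (nu := pushforward pm f : {measure set _ -> \bar R}).
  exact: mf.
have sf : sigma_finite setT nu.
  have /sigma_finiteP[F [FT ndF Foo]] := sigma_finiteT (@lebesgue_measure R).
  have /sigma_finiteP[G [GT ndG Goo]] := sigma_finiteT m.
  pose un (t : d.+1.-tuple T) := (thead t, [tuple of behead t] : d.-tuple T).
  exists (fun k => un @^-1` (F k `*` G k)).
    apply/esym; rewrite -subTset => t _.
    have [i _ Fi] : (\bigcup_i F i) (thead t) by rewrite -FT.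
    have [j _ Gj] : (\bigcup_i G i) [tuple of behead t] by rewrite -GT.
    exists (maxn i j) => //; split => /=.
    - by move: Fi; exact/subsetPset/ndF/leq_maxl.
    - by move: Gj; exact/subsetPset/ndG/leq_maxr.
  move=> k; have [mF Fk] := Foo k; have [mG Gk] := Goo k; split.
    rewrite -[X in measurable X]setTI.
    by apply: measurable_uncons => //; exact: measurableX.
  rewrite /nu/= /pushforward (_ : _ @^-1` _ = F k `*` G k); last first.
    by apply/seteqP; split=> -[x t] /=; rewrite /f /un /=
      behead_cons_tuple theadE.
  by rewrite /pm product_measure1E// lte_mul_pinfty// ge0_fin_numE.
exists (HB.pack_for {sigma_finite_measure set (d.+1.-tuple T) -> \bar R}
  (Measure.sort nu) (Measure.class nu) (Measure_isSigmaFinite.Build _ _ _ nu sf)).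
by rewrite /= mE.
Qed.

Let lam_ge0 d A : (0 <= lam d A)%E.
Proof. by have [m ->] := lebesgue_tuple_sigma_finite_measure d. Qed.

Let lam0 d : lam d set0 = 0.
Proof. by have [m ->] := lebesgue_tuple_sigma_finite_measure d; rewrite measure0. Qed.

Let lam_sigma_additive d : semi_sigma_additive (lam d).
Proof.
have [m ->] := lebesgue_tuple_sigma_finite_measure d.
exact: measure_semi_sigma_additive.
Qed.

Let lam_sigma_finite d : sigma_finite setT (lam d).
Proof.
have [m ->] := lebesgue_tuple_sigma_finite_measure d; exact: sigma_finiteT.
Qed.

HB.instance Definition _ d := isMeasure.Build _ _ _ (lam d)
  (lam0 d) (@lam_ge0 d) (@lam_sigma_additive d).

HB.instance Definition _ d := Measure_isSigmaFinite.Build _ _ _ (lam d)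
  (lam_sigma_finite d).

Lemma measurable_preimage_cons d (A : set (d.+1.-tuple T)) : measurable A ->
  measurable ((fun p : T * d.-tuple T => [tuple of p.1 :: p.2]) @^-1` A).
Proof.
by move=> mA; rewrite -[X in measurable X]setTI; exact: measurable_cons_pair.
Qed.

Lemma lebesgue_tupleS d (A : set (d.+1.-tuple T)) :
  lam d.+1 A = (\int[lebesgue_measure]_x
    lam d [set t : d.-tuple T | A (cons_tuple x t)])%E.
Proof.
apply: eq_integral => x _ /=; congr lebesgue_tuple.
by apply/seteqP; split => t; rewrite /xsection/= inE.
Qed.

(** Integrating out the first coordinate last: the two iterated integrals agree
    on boxes, hence on all measurable sets. *)
Lemma lebesgue_tupleS_swap d (A : set (d.+1.-tuple T)) : measurable A ->
  lam d.+1 A = (\int[lam d]_t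
    lebesgue_measure [set x : T | A (cons_tuple x t)])%E.
Proof.
move=> mA; have mA' := measurable_preimage_cons mA.
rewrite [LHS](@product_measure_unique _ _ _ _ _ lebesgue_measure (lam d)
  (lebesgue_measure \x^ lam d)%E)//; last first.
  by move=> B C mB mC; exact: product_measure2E.
apply: eq_integral => t _ /=; congr (lebesgue_measure _).
by apply/seteqP; split => x; rewrite /ysection/= inE.
Qed.

End TupleMeasure.

(** * Linear change of variables *)

Section LineMeasure.
Context {R : realType}.
Local Notation T := (measurableTypeR R).
Local Notation mu := (@lebesgue_measure R).

(** A translate of Lebesgue measure gives each half-open interval its length,
    and Lebesgue measure is the only measure that does. *)
Lemma lebesgue_measure_shift (c : R) (A : set T) : measurable A ->
  mu [set x | A (x + c)] = mu A.
Proof.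
move=> mA; have mf : measurable_fun [set: T] (fun x : T => (x + c : T)).
  exact: measurable_funD.
rewrite -[LHS]/(pushforward mu (fun x : T => x + c : T) A).
apply/esym/lebesgue_measure_unique => //= _ [[a b]] _ <-.
rewrite /pushforward /= (_ : _ @^-1` _ = `]a - c, b - c]%classic); last first.
  by apply/seteqP; split=> x /=; rewrite !in_itv/= ltrBlDr lerBrDr.
by rewrite !lebesgue_measure_itv/= !lte_fin ltrD2r -!EFinD opprB addrA subrK.
Qed.

Lemma lebesgue_measure_pos_scale (a : R) (A : set T) : 0 < a -> measurable A ->
  (a%:E * mu [set x | A (x * a)%R] = mu A)%E.
Proof.
move=> a0 mA; have mf : measurable_fun [set: T] (fun x : T => (x * a : T)).
  exact: measurable_funM.
unshelve epose (nu := pushforward mu (fun x : T => x * a : T) :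
  {measure set T -> \bar R}); first exact: mf.
rewrite -[LHS]/(mscale (NngNum (ltW a0)) nu A).
apply/esym/lebesgue_measure_unique => //= _ [[b c]] _ <-.
rewrite /mscale /nu /= /pushforward (_ : _ @^-1` _ = `]b / a, c / a]%classic); last first.
  by apply/seteqP; split=> x /=; rewrite !in_itv/= ltr_pdivrMr// ler_pdivlMr.
rewrite !lebesgue_measure_itv/= !lte_fin ltr_pM2r ?invr_gt0//.
by case: ifP => _; rewrite ?mule0// -EFinM -mulrBl mulrCA divff ?mulr1// gt_eqF.
Qed.

Lemma lebesgue_measure_scale (a : R) (A : set T) : a != 0 -> measurable A ->
  (`|a|%:E * mu [set x | A (x * a)%R] = mu A)%E.
Proof.
move=> a0 mA; have [a_gt0|a_le0] := ltP 0 a.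
  by rewrite gtr0_norm// lebesgue_measure_pos_scale.
have a_lt0 : a < 0 by rewrite lt_neqAle a0.
have mN : measurable [set x : T | A (- x)].
  by rewrite -[X in measurable X]setTI; apply: measurable_funN.
rewrite -[in RHS]lebesgue_measureN// /pushforward.
rewrite ltr0_norm// -(@lebesgue_measure_pos_scale (- a) _ _ mN) ?oppr_gt0//.
congr (_ * mu _)%E; apply/seteqP; split=> x /=; by rewrite mulrN opprK.
Qed.

End LineMeasure.

Section Scales.
Context {R : realType}.
Local Notation T := (measurableTypeR R).
Local Notation mu := (@lebesgue_measure R).
Local Notation lam d := (@lebesgue_tuple R d).

Lemma measurable_cons_left d (A : set (d.+1.-tuple T)) (x : T) :
  measurable A -> measurable [set t : d.-tuple T | A (cons_tuple x t)].
Proof.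
by move=> mA; rewrite -[X in measurable X]setTI; exact: measurable_cons.
Qed.

Lemma measurable_cons_right d (A : set (d.+1.-tuple T)) (t : d.-tuple T) :
  measurable A -> measurable [set x : T | A (cons_tuple x t)].
Proof.
by move=> mA; rewrite -[X in measurable X]setTI; exact: measurable_cons.
Qed.

Lemma measurable_fun_slice_left d (A : set (d.+1.-tuple T)) : measurable A ->
  measurable_fun [set: T] (fun x => lam d [set t | A (cons_tuple x t)]).
Proof.
move=> mA; have mA' := measurable_preimage_cons mA.
have := measurable_fun_xsection (lam d) mA'; apply: eq_measurable_fun => x _.
by congr lebesgue_tuple; apply/seteqP; split => t; rewrite /xsection/= inE.
Qed.

Lemma measurable_fun_slice_right d (A : set (d.+1.-tuple T)) : measurable A ->
  measurable_fun [set: d.-tuple T] (fun t => mu [set x | A (cons_tuple x t)]).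
Proof.
move=> mA; have mA' := measurable_preimage_cons mA.
have := measurable_fun_ysection mu mA'; apply: eq_measurable_fun => t _.
by congr (mu _); apply/seteqP; split => x; rewrite /ysection/= inE.
Qed.

(** Volumes are compared through preimages, so that neither injectivity of [f]
    nor measurability of direct images has to be known beforehand.  For an
    invertible affine [f], the factor [k] is the absolute determinant. *)
Definition scales d (k : R) (f : d.-tuple T -> d.-tuple T) :=
  measurable_fun setT f /\
  forall A, measurable A -> (k%:E * lam d (f @^-1` A) = lam d A)%E.

Lemma scales_id d : scales 1 (@id (d.-tuple T)).
Proof. by split=> // A mA; rewrite mul1e. Qed.

Lemma scales_comp d k1 k2 (f g : d.-tuple T -> d.-tuple T) :
  scales k1 f -> scales k2 g -> scales (k1 * k2) (g \o f).
Proof.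
move=> [mf fE] [mg gE]; split; first exact: measurableT_comp.
move=> A mA; have mgA : measurable (g @^-1` A).
  by rewrite -[X in measurable X]setTI; exact: mg.
by rewrite mulrC EFinM -muleA comp_preimage fE// gE.
Qed.

(** Tonelli: a map that fixes the first coordinate and scales every slice by [k]
    scales the whole space by [k].  The map on the slices may depend on the
    slice, which covers shears. *)
Lemma scales_left d k (f : d.+1.-tuple T -> d.+1.-tuple T)
    (h : T -> d.-tuple T -> d.-tuple T) :
  0 <= k -> measurable_fun setT f -> (forall x, scales k (h x)) ->
  (forall x t, f (cons_tuple x t) = cons_tuple x (h x t)) -> scales k f.
Proof.
move=> k0 mf sh fE; split => // A mA.
have mfA : measurable (f @^-1` A) by rewrite -[X in measurable X]setTI; exact: mf.
rewrite !lebesgue_tupleS -ge0_integralZl//; last exact: measurable_fun_slice_left.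
apply: eq_integral => x _ /=.
rewrite -(proj2 (sh x) _ (measurable_cons_left x mA)).
by congr (_ * lam d _)%E; apply/seteqP; split => t /=; rewrite fE.
Qed.

(** The same principle for maps that move the first coordinate only; it uses the
    other order of integration. *)
Lemma scales_right d k (f : d.+1.-tuple T -> d.+1.-tuple T)
    (h : d.-tuple T -> T -> T) :
  0 <= k -> measurable_fun setT f ->
  (forall t A, measurable A -> (k%:E * mu [set x | A (h t x)] = mu A)%E) ->
  (forall x t, f (cons_tuple x t) = cons_tuple (h t x) t) -> scales k f.
Proof.
move=> k0 mf sh fE; split => // A mA.
have mfA : measurable (f @^-1` A) by rewrite -[X in measurable X]setTI; exact: mf.
rewrite !lebesgue_tupleS_swap// -ge0_integralZl//; last exact: measurable_fun_slice_right.
apply: eq_integral => t _ /=.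
rewrite -(sh t _ (measurable_cons_right t mA)).
by congr (_ * mu _)%E; apply/seteqP; split => x /=; rewrite fE.
Qed.
End Scales.

Section ChangeOfVariables.
Context {R : realType}.
Local Notation T := (measurableTypeR R).
Local Notation lam d := (@lebesgue_tuple R d).

Definition row_of_tuple d (t : d.-tuple R) : 'rV[R]_d := \row_j tnth t j.
Definition tuple_of_row d (v : 'rV[R]_d) : d.-tuple R := [tuple v 0 j | j < d].

Lemma row_of_tupleK d : cancel (@row_of_tuple d) (@tuple_of_row d).
Proof. by move=> t; apply: eq_from_tnth => j; rewrite tnth_mktuple mxE. Qed.

Lemma tuple_of_rowK d : cancel (@tuple_of_row d) (@row_of_tuple d).
Proof. by move=> v; apply/rowP => j; rewrite mxE tnth_mktuple. Qed.

Lemma row_of_cons d (x : R) (t : d.-tuple R) :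
  row_of_tuple (cons_tuple x t) = row_mx x%:M (row_of_tuple t).
Proof.
apply/rowP => j; case: (unliftP ord0 j) => [k ->|->]; rewrite mxE.
  rewrite tnthS (_ : lift ord0 k = rshift 1 k); last exact/val_inj.
  by rewrite (@row_mxEr _ 1 1 d) mxE.
rewrite tnth0 (_ : ord0 = lshift d (0 : 'I_1)); last exact/val_inj.
by rewrite (@row_mxEl _ 1 1 d) mxE.
Qed.

Lemma measurable_affine d (M : 'M[R]_d) (s : 'rV[R]_d) :
  measurable_fun [set: d.-tuple T]
    (fun t : d.-tuple T => tuple_of_row (row_of_tuple t *m M + s) : d.-tuple T).
Proof.
apply/measurable_fun_tnthP => j.
rewrite (_ : _ \o _ = fun t : d.-tuple T => \sum_i tnth t i * M i j + s 0 j); last first.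
  apply/funext => t /=; rewrite tnth_mktuple !mxE; congr (_ + _).
  by apply: eq_bigr => i _; rewrite mxE.
apply: measurable_funD => //; apply: measurable_sum => i.
by apply: measurable_funM => //; exact: measurable_tnth.
Qed.

Definition tmulmx d (M : 'M[R]_d) (t : d.-tuple T) : d.-tuple T :=
  tuple_of_row (row_of_tuple t *m M).

Definition tshift d (s : 'rV[R]_d) (t : d.-tuple T) : d.-tuple T :=
  tuple_of_row (row_of_tuple t + s).

Lemma measurable_tmulmx d (M : 'M[R]_d) : measurable_fun setT (tmulmx M).
Proof.
rewrite (_ : tmulmx M = fun t => tuple_of_row (row_of_tuple t *m M + 0)).
  exact: measurable_affine.
by apply/funext => t; rewrite addr0.
Qed.

Lemma measurable_tshift d (s : 'rV[R]_d) : measurable_fun setT (tshift s).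
Proof.
rewrite (_ : tshift s = fun t => tuple_of_row (row_of_tuple t *m 1%:M + s)).
  exact: measurable_affine.
by apply/funext => t; rewrite mulmx1.
Qed.

Lemma tmulmxM d (M N : 'M[R]_d) : tmulmx (M *m N) = tmulmx N \o tmulmx M.
Proof. by apply/funext => t /=; rewrite /tmulmx tuple_of_rowK mulmxA. Qed.

Lemma row_of_tshift_cons d (s0 : 'M[R]_1) (s1 : 'rV[R]_d) x (t : d.-tuple R) :
  row_of_tuple (@tshift d.+1 (row_mx s0 s1 : 'rV[R]_(1 + d)) (cons_tuple x t)) =
  row_mx (x%:M + s0) (row_of_tuple t + s1).
Proof. by rewrite tuple_of_rowK row_of_cons; exact: (@add_row_mx R 1 1 d). Qed.

Lemma row_of_tmulmx_cons d (a : 'M[R]_1) (r : 'rV[R]_d) c D x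
    (t : d.-tuple R) :
  row_of_tuple (@tmulmx d.+1 (block_mx a r c D : 'M[R]_(1 + d)) (cons_tuple x t)) =
  row_mx (x%:M *m a + row_of_tuple t *m c) (x%:M *m r + row_of_tuple t *m D).
Proof. by rewrite tuple_of_rowK row_of_cons; exact: (@mul_row_block R 1 1 d 1 d). Qed.

Lemma scales_tshift d (s : 'rV[R]_d) : scales 1 (tshift s).
Proof.
elim: d s => [|d IHd] s.
  rewrite (_ : tshift s = id); first exact: scales_id.
  by apply/funext => t; rewrite [LHS]tuple0 [RHS]tuple0.
pose s0 : 'rV_1 := lsubmx (s : 'rV_(1 + d)).
pose s1 : 'rV_d := rsubmx (s : 'rV_(1 + d)).
have sE : s = row_mx 0 s1 + row_mx s0 0.
  by rewrite add_row_mx add0r addr0 hsubmxK.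
have -> : tshift s = @tshift d.+1 (row_mx s0 0 : 'rV_(1 + d)) \o
    @tshift d.+1 (row_mx 0 s1 : 'rV_(1 + d)).
  apply/funext => t; rewrite /= /tshift tuple_of_rowK -addrA.
  by congr (tuple_of_row (_ + _)).
rewrite -[1]mulr1; apply: scales_comp.
  apply: (@scales_left _ _ _ _ (fun _ => tshift s1)) => //.
  - exact: measurable_tshift.
  - move=> x t; apply: (can_inj (@row_of_tupleK _)).
    by rewrite row_of_tshift_cons row_of_cons tuple_of_rowK addr0.
apply: (@scales_right _ _ _ _ (fun _ x => x + s0 0 0)) => //.
- exact: measurable_tshift.
- by move=> t A mA; rewrite mul1e lebesgue_measure_shift.
- move=> x t; apply: (can_inj (@row_of_tupleK _)).
  rewrite row_of_tshift_cons row_of_cons addr0.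
  by rewrite raddfD/= -mx11_scalar.
Qed.

Lemma scales_ushear d (r : 'rV[R]_d) :
  scales 1 (@tmulmx d.+1 (block_mx 1%:M r 0 1%:M : 'M[R]_(1 + d))).
Proof.
apply: (@scales_left _ _ _ _ (fun x => tshift (x *: r))) => //.
- exact: measurable_tmulmx.
- by move=> x; exact: scales_tshift.
- move=> x t; apply: (can_inj (@row_of_tupleK _)).
  rewrite row_of_tmulmx_cons row_of_cons ?tuple_of_rowK !mulmx1 mulmx0 addr0.
  by rewrite mul_scalar_mx addrC.
Qed.

Lemma scales_lshear d (c : 'cV[R]_d) :
  scales 1 (@tmulmx d.+1 (block_mx 1%:M 0 c 1%:M : 'M[R]_(1 + d))).
Proof.
apply: (@scales_right _ _ _ _ (fun t x => x + (row_of_tuple t *m c) 0 0)) => //.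
- exact: measurable_tmulmx.
- by move=> t A mA; rewrite mul1e lebesgue_measure_shift.
- move=> x t; apply: (can_inj (@row_of_tupleK _)).
  rewrite row_of_tmulmx_cons row_of_cons ?tuple_of_rowK !mulmx1 mulmx0 add0r.
  by rewrite raddfD/= -mx11_scalar.
Qed.

Lemma scales_first d (a : R) : a != 0 ->
  scales `|a| (@tmulmx d.+1 (block_mx a%:M 0 0 1%:M : 'M[R]_(1 + d))).
Proof.
move=> a0; apply: (@scales_right _ _ _ _ (fun t x => x * a)) => //.
- exact: measurable_tmulmx.
- by move=> t A mA; exact: lebesgue_measure_scale.
- move=> x t; apply: (can_inj (@row_of_tupleK _)).
  rewrite row_of_tmulmx_cons row_of_cons ?tuple_of_rowK !mulmx1 !mulmx0 add0r addr0.
  by rewrite -scalar_mxM.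
Qed.

Lemma scales_rest d (M : 'M[R]_d) : scales `|\det M| (tmulmx M) ->
  scales `|\det M| (@tmulmx d.+1 (block_mx 1%:M 0 0 M : 'M[R]_(1 + d))).
Proof.
move=> sM; apply: (@scales_left _ _ _ _ (fun _ => tmulmx M)) => //.
- exact: measurable_tmulmx.
- move=> x t; apply: (can_inj (@row_of_tupleK _)).
  rewrite row_of_tmulmx_cons row_of_cons ?tuple_of_rowK !mulmx1 !mulmx0 add0r addr0.
  by [].
Qed.

(** Gaussian elimination on the first coordinate: a matrix with nonzero top left
    entry [a] is a product of a lower shear, a map of the other coordinates, a
    dilation of the first one, and an upper shear; the determinant is [a] times
    that of the Schur complement [D'].  If [a = 0], some other entry of the
    first column is nonzero, and one more shear brings it to the pivot. *)
Theorem scales_tmulmx d (M : 'M[R]_d) : \det M != 0 -> scales `|\det M| (tmulmx M).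
Proof.
elim: d M => [|d IHd] M.
  move=> _; rewrite det_mx00 normr1 (_ : tmulmx M = id); first exact: scales_id.
  by apply/funext => t; rewrite [LHS]tuple0 [RHS]tuple0.
have pivot (a : R) (r : 'rV_d) (c : 'cV_d) (D : 'M[R]_d) : a != 0 ->
    \det (block_mx a%:M r c D) != 0 ->
    scales `|\det (block_mx a%:M r c D)|
      (@tmulmx d.+1 (block_mx a%:M r c D : 'M[R]_(1 + d))).
  move=> a0; pose D' := D - a^-1 *: (c *m r).
  have ME : block_mx a%:M r c D = block_mx 1%:M 0 (a^-1 *: c) 1%:M *m
      block_mx 1%:M 0 0 D' *m (block_mx a%:M 0 0 1%:M *m
      block_mx 1%:M (a^-1 *: r) 0 1%:M).
    rewrite !mulmx_block !(mulmx0, mul0mx, mulmx1, mul1mx, addr0, add0r).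
    rewrite -!scalemxAl -!scalemxAr !mul_mx_scalar !mul_scalar_mx.
    by rewrite !scalerA mulVf// !scale1r -scalemxAr scalerA divfK// addrC subrK.
  have dE : \det (block_mx a%:M r c D) = \det D' * a.
    by rewrite ME !det_mulmx !(det_lblock, det_ublock) !det1 det_scalar1 !mulr1 !mul1r.
  rewrite dE mulf_eq0 negb_or => /andP[D'0 _].
  rewrite normrM ME !(@tmulmxM d.+1).
  rewrite -[_ * `|a|]mul1r mulrA -[`|a|]mulr1.
  apply: scales_comp; apply: scales_comp.
  - exact: scales_lshear.
  - exact/scales_rest/IHd.
  - exact: scales_first.
  - exact: scales_ushear.
rewrite -[M](@submxK _ 1 d 1 d) [ulsubmx _]mx11_scalar.
move: (ulsubmx _ 0 0) (ursubmx _) (dlsubmx _) (drsubmx _) => {M} a r c D.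
have [->|a0] := eqVneq a 0; last exact: pivot.
move=> d0; have [j cj] : exists j, c j 0 != 0.
  apply/existsP; apply: contraNT d0; rewrite negb_exists => /forallP c0.
  have -> : c = 0 by apply/colP => j; rewrite mxE; apply/eqP/negPn.
  by rewrite raddf0 (@det_ublock R 1 d) det0 mul0r.
pose N : 'M[R]_(1 + d) := block_mx 1%:M (- delta_mx 0 j) 0 1%:M.
pose N' : 'M[R]_(1 + d) := block_mx 1%:M (delta_mx 0 j) 0 1%:M.
set M : 'M[R]_(1 + d) := block_mx 0%:M r c D in d0 *.
have ME : M = N *m (N' *m M).
  by rewrite mulmxA mulmx_block !(mulmx0, mul0mx, mulmx1, mul1mx, addr0, add0r)
    subrr -scalar_mx_block mul1mx.
have N'M : N' *m M = block_mx (c j 0)%:M (r + row j D) c D.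
  rewrite mulmx_block !(mulmx0, mul0mx, mulmx1, mul1mx, addr0, add0r) -!rowE.
  by rewrite raddf0 add0r [row j c]mx11_scalar mxE.
have dE : \det M = \det (N' *m M).
  by rewrite {1}ME det_mulmx det_ublock !det1 !mul1r.
rewrite dE {2}ME (@tmulmxM d.+1) N'M -[`|_|]mul1r.
apply: scales_comp; first exact: scales_ushear.
by apply: pivot => //; rewrite -N'M -dE.
Qed.

End ChangeOfVariables.

(** * Hyperplanes, boxes and the standard simplex *)

Section NullAndSimplex.
Context {R : realType}.
Local Notation T := (measurableTypeR R).
Local Notation mu := (@lebesgue_measure R).
Local Notation lam d := (@lebesgue_tuple R d).

Lemma tnth_cons_lift d (x : R) (t : d.-tuple R) i :
  tnth (cons_tuple x t) (lift ord0 i) = tnth t i.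
Proof. exact: tnthS. Qed.

Lemma measurable_affine_form d (a : 'I_d -> R) (c : R) :
  measurable_fun [set: d.-tuple T] (fun t => c + \sum_i tnth t i * a i : T).
Proof.
apply: measurable_funD => //; apply: measurable_sum => i.
by apply: measurable_funM => //; exact: measurable_tnth.
Qed.

Lemma measurable_hyperplane d (a : 'I_d -> R) (c : R) :
  measurable [set t : d.-tuple T | c + \sum_i tnth t i * a i = 0].
Proof.
rewrite -[X in measurable X]setTI.
exact: (measurable_affine_form a c measurableT (measurable_set1 0)).
Qed.

(** Fubini along the first coordinate.  If the form involves another coordinate,
    every slice is a hyperplane; otherwise only one slice is nonempty. *)
Lemma hyperplane_null d (a : 'I_d -> R) (c : R) : (exists i, a i != 0) ->
  lam d [set t | c + \sum_i tnth t i * a i = 0] = 0.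
Proof.
elim: d a c => [|d IHd] a c [i ai]; first by case: i ai.
have formE (x : R) t : c + \sum_i tnth (cons_tuple x t) i * a i =
    (c + x * a ord0) + \sum_i tnth t i * a (lift ord0 i).
  rewrite big_ord_recl tnth0 addrA; congr (_ + _).
  by apply: eq_bigr => i' _; rewrite tnth_cons_lift.
have sliceE (x : R) :
    [set t : d.-tuple T | c + \sum_i tnth (cons_tuple x t) i * a i = 0] =
    [set t | (c + x * a ord0) + \sum_i tnth t i * a (lift ord0 i) = 0].
  by apply/seteqP; split => t /=; rewrite formE.
rewrite lebesgue_tupleS; have [[j aj]|noa] := pselect (exists j, a (lift ord0 j) != 0).
  by apply: integral0_eq => x _ /=; rewrite sliceE; apply: IHd; exists j.
have a0 j : a (lift ord0 j) = 0.
  by apply/eqP; apply: contra_notT noa => aj; exists j.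
have {ai}a00 : a ord0 != 0 by case: (unliftP ord0 i) ai => [j|] ->; rewrite ?a0 ?eqxx.
transitivity (\int[mu]_x (lam d setT * (\1_[set (- c / a ord0)%R] x)%:E))%E.
  apply: eq_integral => x _; rewrite sliceE indicE.
  have [/set_mem/= ->|/negP xN] := boolP (x \in _).
    rewrite mule1; congr lebesgue_tuple; apply/seteqP; split => // t _ /=.
    by rewrite mulfVK// big1 ?addr0 ?subrr// => j _; rewrite a0 mulr0.
  rewrite mule0 -(measure0 (lam d)); congr lebesgue_tuple.
  apply/seteqP; split => // t /=; rewrite big1 ?addr0; last by move=> j _; rewrite a0 mulr0.
  move=> /eqP; rewrite addrC addr_eq0 => /eqP xE.
  by apply: xN; apply/mem_set; rewrite /= -xE mulfK.
rewrite ge0_integralZl//.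
  by rewrite integral_indic// setIT [X in (_ * X)%E]lebesgue_measure_set1 mule0.
exact/measurable_EFinP/measurable_indic.
Qed.

Definition box (d : nat) (r : R) : set (d.-tuple T) :=
  [set t | forall i, 0 <= tnth t i <= r].

Lemma lebesgue_tuple_box d (r : R) : 0 <= r -> lam d (@box d r) = (r ^+ d)%:E.
Proof.
move=> r0; elim: d => [|d IHd].
  by rewrite /= diracE mem_set// => -[].
rewrite lebesgue_tupleS.
transitivity (\int[mu]_x ((r ^+ d)%:E * (\1_(`[0%R, r]%classic) x)%:E))%E.
  apply: eq_integral => x _; rewrite indicE.
  have [/set_mem/= xr|/negP xN] := boolP (x \in _).
    rewrite mule1 -IHd; congr lebesgue_tuple; apply/seteqP; split => t /= bt i.
      by have := bt (lift ord0 i); rewrite tnth_cons_lift.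
    by case: (unliftP ord0 i) => [j|] ->; rewrite ?tnth_cons_lift ?tnth0.
  rewrite mule0 -(measure0 (lam d)); congr lebesgue_tuple.
  apply/seteqP; split => // t /= /(_ ord0); rewrite tnth0 => xr.
  by apply: xN; apply/mem_set; rewrite /= in_itv.
rewrite ge0_integralZl ?lee_fin ?exprn_ge0//.
  rewrite integral_indic//.
  rewrite setIT [X in (_ * X)%E]lebesgue_measure_itv/= lte_fin oppr0 adde0 exprSr.
  by move: r0; rewrite le_eqVlt => /orP[/eqP <-|->]; rewrite ?ltxx ?mulr0 ?mule0.
by apply/measurable_EFinP/measurable_indic; exact: measurable_itv.
Qed.

Lemma measurable_box d (r : R) : measurable (@box d r).
Proof.
rewrite (_ : @box d r = \bigcap_(i in [set: 'I_d]) ((@tnth d T)^~ i @^-1` `[0, r]%classic)).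
  apply: fin_bigcap_measurable => // i _.
  by rewrite -[X in measurable X]setTI; apply: measurable_tnth => //; exact: measurable_itv.
apply/seteqP; split => t /= bt i; last by have := bt i Logic.I; rewrite /= in_itv.
by move=> _ /=; rewrite in_itv; exact: bt.
Qed.

Definition std_simplex d : set (d.-tuple T) :=
  [set t | (forall i, 0 <= tnth t i) /\ \sum_i tnth t i <= 1].

Lemma measurable_std_simplex d : measurable (@std_simplex d).
Proof.
rewrite (_ : @std_simplex d =
    \bigcap_(i in [set: 'I_d]) ((@tnth d T)^~ i @^-1` `[0, +oo[%classic) `&`
    (fun t => \sum_i tnth t i : T) @^-1` `]-oo, 1]%classic).
  apply: measurableI.
    apply: fin_bigcap_measurable => // i _.
    by rewrite -[X in measurable X]setTI; apply: measurable_tnth => //; exact: measurable_itv.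
  rewrite -[X in measurable X]setTI; apply: measurable_sum => // i.
  exact: measurable_tnth.
apply/seteqP; split => t /= [t0 t1]; split => //.
- by move=> i _ /=; rewrite in_itv/= andbT.
- by move=> i; have := t0 i Logic.I; rewrite /= in_itv/= andbT.
Qed.

(** The exact volume of the standard simplex cancels out of all normalized
    volumes, so only its being positive and finite matters.  It is squeezed
    between the cubes of side [1 / (d + 1)] and [1]. *)
Lemma lebesgue_std_simplex_gt0 d : (0 < lam d (@std_simplex d))%E.
Proof.
apply: (@lt_le_trans _ _ (lam d (@box d d.+1%:R^-1))).
  by rewrite lebesgue_tuple_box ?invr_ge0// lte_fin exprn_gt0// invr_gt0.
apply: le_measure; rewrite ?inE; [exact: measurable_box|exact: measurable_std_simplex|].
move=> t bt; split=> [i|]; first by case/andP: (bt i).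
apply: (@le_trans _ _ (\sum_(i < d) d.+1%:R^-1)).
  by apply: ler_sum => i _; case/andP: (bt i).
by rewrite sumr_const card_ord -[_ *+ d]mulr_natl ler_pdivrMr// mul1r ler_nat.
Qed.

Lemma lebesgue_std_simplex_fin_num d : lam d (@std_simplex d) \is a fin_num.
Proof.
rewrite ge0_fin_numE//; apply: (@le_lt_trans _ _ (lam d (@box d 1))).
  apply: le_measure; rewrite ?inE; [exact: measurable_std_simplex|exact: measurable_box|].
  move=> t [t0 t1] i; rewrite t0/=; apply: le_trans t1.
  by rewrite (bigD1 i)//= lerDl sumr_ge0.
by rewrite lebesgue_tuple_box// ltry.
Qed.

End NullAndSimplex.

(** * Simplices seen through an affine chart *)

(** A convex combination of points taken from a finite family becomes one
    indexed by the family itself once equal points are merged. *)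
Lemma conv_hull_range (R : realType) (E : lmodType R) (J : finType) (g : J -> E) :
  conv_hull (range g) = [set x | exists c : J -> R,
    [/\ forall j, 0 <= c j, \sum_j c j = 1 & x = \sum_j c j *: g j]].
Proof.
apply/seteqP; split => x /=.
  move=> [m [p [c [gp c0 c1 ->]]]].
  have /choice[s sP] : forall i, exists j, g j = p i.
    by move=> i; have [j _ <-] := gp i; exists j.
  exists (fun j => \sum_(i | s i == j) c i); split.
  - by move=> j; exact: sumr_ge0.
  - by rewrite -c1 [RHS](partition_big s xpredT).
  - rewrite (partition_big s xpredT)//=; apply: eq_bigr => j _.
    by rewrite scaler_suml; apply: eq_bigr => i /eqP <-; rewrite sP.
move=> [c [c0 c1 ->]]; exists #|J|, (g \o enum_val), (c \o enum_val).
split => //=.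
- by move=> i; exists (enum_val i).
- by rewrite -c1 [RHS](reindex (@enum_val J J)) //=; apply: onW_bij; exact: enum_val_bij.
- by rewrite [LHS](reindex (@enum_val J J)) //=; apply: onW_bij; exact: enum_val_bij.
Qed.

Lemma det_int (R : archiRealDomainType) n (M : 'M[R]_n) :
  (forall i j, M i j \is a Num.int) -> \det M \is a Num.int.
Proof.
move=> Mi; apply: rpred_sum => s _; apply: rpredM; last exact: rpred_prod.
by rewrite rpredX ?rpredN ?rpred1.
Qed.

Lemma norm_int_unit (R : archiRealDomainType) (x y : R) :
  x \is a Num.int -> y \is a Num.int -> x * y = 1 -> `|x| = 1.
Proof.
case/intrP => a ->; case/intrP => b ->.
move=> /eqP; rewrite -intrM -[1]/(1%:~R) eqr_int => /eqP/(congr1 absz).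
rewrite abszM => /eqP; rewrite muln_eq1 => /andP[/eqP a1 _].
by rewrite -intr_norm -abszE a1.
Qed.

Section Charts.
Context {R : realType} {I : finType}.
Local Notation T := (measurableTypeR R).
Local Notation E := {ffun I -> R^o}.
Local Notation lam d := (@lebesgue_tuple R d).

Definition unit_sum : set E := [set x | \sum_k x k = 1].

Lemma unit_sum_comb (J : finType) (c : J -> R) (g : J -> E) :
  (forall j, unit_sum (g j)) -> \sum_k (\sum_j c j *: g j) k = \sum_j c j.
Proof.
move=> gA; under eq_bigr do rewrite sum_ffunE.
rewrite exchange_big; apply: eq_bigr => j _.
transitivity (c j * \sum_k g j k); last by rewrite gA mulr1.
by rewrite mulr_sumr; apply: eq_bigr => k _; rewrite ffunE.
Qed.

Section Chart.
Variables (d : nat) (o : E) (b : 'I_d -> E) (e : 'I_d.+1 -> I).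
Hypotheses (chart : affine_chart unit_sum o b) (e_bij : bijective e).

Definition coord_row (x : E) : 'rV[R]_d.+1 := \row_j x (e j).
(** The bijection [e] orders the coordinates; using it for the vertices as well
    makes the matrix square and its determinant independent of [e]. *)
Definition coord_mx (g : I -> E) : 'M[R]_d.+1 := \matrix_(i, j) g (e i) (e j).
(** The matrix of the chart in homogeneous coordinates: [(1, t)] times this
    matrix is the point with parameter [t]. *)
Definition chart_mx : 'M[R]_d.+1 :=
  col_mx (coord_row o) (\matrix_(i, j) b i (e j)).

Lemma coord_row_affine_map (t : d.-tuple R) :
  coord_row (affine_map o b t) =
  coord_row o + row_of_tuple t *m \matrix_(i, j) b i (e j).
Proof.
apply/rowP => j; rewrite !mxE /affine_map ffunE sum_ffunE; congr (_ + _).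
by apply: eq_bigr => i _; rewrite !mxE ffunE.
Qed.

Lemma affine_map_comb m (c : 'I_m -> R) (t : 'I_m -> d.-tuple R) :
  \sum_i c i = 1 ->
  \sum_i c i *: affine_map o b (t i) =
  affine_map o b (tuple_of_row (\sum_i c i *: row_of_tuple (t i))).
Proof.
move=> c1; apply/ffunP => k; rewrite sum_ffunE /affine_map ffunE sum_ffunE.
under eq_bigr do rewrite !ffunE sum_ffunE scalerDr.
rewrite big_split /= -scaler_suml c1 scale1r; congr (_ + _).
under eq_bigr do rewrite scaler_sumr.
rewrite exchange_big; apply: eq_bigr => i _ /=.
rewrite ffunE tnth_mktuple summxE scaler_suml; apply: eq_bigr => j _.
by rewrite !mxE ffunE /= scalerA.
Qed.

(** In the chart, the simplex on [g] is the image of the standard simplex under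
    an affine map with linear part [B], the matrix of edge vectors at the first
    vertex.  Homogenizing, [coord_mx g] is a unipotent matrix times
    [block_mx 1 t0 0 B] times [chart_mx], so that
    [det (coord_mx g) = det B * det chart_mx] and the change of variables
    formula gives the volume. *)
Lemma simplex_volume (g : I -> E) : (forall k, unit_sum (g k)) ->
  \det (coord_mx g) != 0 ->
  [/\ \det chart_mx != 0,
      measurable (affine_map o b @^-1` conv_hull (range g) : set (d.-tuple T)) &
      (`|\det chart_mx|%:E * lam d (affine_map o b @^-1` conv_hull (range g)) =
       `|\det (coord_mx g)|%:E * lam d (@std_simplex R d))%E].
Proof.
move=> gA dg.
have /choice[t tP] : forall i, exists t, affine_map o b t = g (e i).
  by move=> i; have := gA (e i); rewrite -(proj2 chart) => -[t _ <-]; exists t.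
have inj := proj1 chart.
pose t0 := row_of_tuple (t ord0).
pose B : 'M[R]_d := \matrix_(i < d) (row_of_tuple (t (lift ord0 i)) - t0).
have gE : coord_mx g = block_mx 1%:M 0 (const_mx 1) 1%:M *m
    (block_mx 1%:M t0 0 B *m chart_mx).
  have gtE i j : g (e i) (e j) =
      (coord_row o + row_of_tuple (t i) *m \matrix_(i, j) b i (e j)) 0 j.
    by rewrite -coord_row_affine_map mxE tP.
  rewrite mulmxA mulmx_block !(mulmx0, mul0mx, mulmx1, mul1mx, addr0, add0r).
  rewrite /chart_mx (@mul_block_col R 1 d 1 d) mul1mx.
  have -> : const_mx 1 *m t0 + B = \matrix_i row_of_tuple (t (lift ord0 i)).
    by apply/matrixP => i j; rewrite !mxE big_ord1 !mxE mul1r addrC subrK.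
  apply/matrixP => i j; rewrite mxE gtE; case: (unliftP ord0 i) => [k ->|->].
    rewrite [in RHS](_ : lift ord0 k = rshift 1 k); last exact/val_inj.
    rewrite (@col_mxEd R 1 d) [RHS]mxE [LHS]mxE; congr (_ + _).
      by rewrite [RHS]mxE big_ord1 [const_mx _ _ _]mxE mul1r.
    by rewrite !mxE; apply: eq_bigr => l _; rewrite !mxE.
  rewrite [in RHS](_ : ord0 = lshift d (0 : 'I_1)); last exact/val_inj.
  by rewrite (@col_mxEu R 1 d).
have dE : \det (coord_mx g) = \det B * \det chart_mx.
  by rewrite gE !det_mulmx (@det_lblock R 1 d) (@det_ublock R 1 d) !det1 !mul1r.
have /andP[dB dc] : (\det B != 0) && (\det chart_mx != 0).
  by rewrite -negb_or -mulf_eq0 -dE.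
pose G : d.-tuple T -> d.-tuple T := tshift t0 \o tmulmx B.
pose G' : d.-tuple T -> d.-tuple T := tmulmx (invmx B) \o tshift (- t0).
have uB : B \in unitmx by rewrite unitmxE unitfE.
have GK : cancel G G'.
  by move=> u; rewrite /G /G' /tshift /tmulmx /= !tuple_of_rowK addrK mulmxK ?row_of_tupleK.
have G'K : cancel G' G.
  by move=> u; rewrite /G /G' /tshift /tmulmx /= !tuple_of_rowK mulmxKV// subrK row_of_tupleK.
(* Barycentric coordinates of the point of parameter u; the first one is
   determined by the others. *)
pose c (u : d.-tuple R) (i : 'I_d.+1) : R :=
  if unlift ord0 i is Some j then tnth u j else 1 - \sum_j tnth u j.
have c_0 u : c u ord0 = 1 - \sum_j tnth u j by rewrite /c unlift_none.
have c_lift u j : c u (lift ord0 j) = tnth u j by rewrite /c liftK.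
have c1 u : \sum_i c u i = 1.
  by rewrite big_ord_recl c_0 (eq_bigr _ (fun j _ => c_lift u j)) subrK.
have GE u : affine_map o b (G u) = \sum_i c u i *: g (e i).
  under eq_bigr do rewrite -tP.
  rewrite affine_map_comb//; congr (affine_map o b (tuple_of_row _)).
  rewrite big_ord_recl; under [in RHS]eq_bigr do rewrite c_lift.
  rewrite c_0 /tmulmx tuple_of_rowK scalerBl scale1r -/t0 addrC addrAC -addrA; congr (_ + _).
  rewrite scaler_suml -sumrB; apply/rowP => j; rewrite !mxE summxE.
  by apply: eq_bigr => i _; rewrite !mxE; ring.
set S := _ @^-1` _.
have SE : S = G' @^-1` (@std_simplex R d).
  rewrite /S conv_hull_range; apply/seteqP; split => t' /=.
    move=> [a [a0 a1 tE]]; pose u := [tuple a (e (lift ord0 i)) | i < d].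
    have ae1 : a (e ord0) + \sum_i a (e (lift ord0 i)) = 1.
      rewrite -a1 [RHS](reindex e)/=; last exact: onW_bij.
      by rewrite [RHS]big_ord_recl.
    suff -> : t' = G u.
      rewrite GK; split => [i|]; first by rewrite tnth_mktuple.
      by under eq_bigr do rewrite tnth_mktuple; rewrite -ae1 lerDr.
    apply: inj; rewrite tE GE (reindex e)/=; last exact: onW_bij.
    apply: eq_bigr => i _; congr (_ *: _).
    case: (unliftP ord0 i) => [j ->|->]; first by rewrite c_lift tnth_mktuple.
    by rewrite c_0; under eq_bigr do rewrite tnth_mktuple; rewrite -ae1 addrK.
  have [e' eK e'K] := e_bij.
  move=> [u0 u1]; rewrite -[t']G'K GE; exists (c (G' t') \o e'); split.
  - move=> j; rewrite /= /c; case: unliftP => [i _|_] //.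
    by rewrite subr_ge0.
  - rewrite -[RHS](c1 (G' t')) [LHS](reindex e)/=; last exact: onW_bij.
    by apply: eq_bigr => i _; rewrite eK.
  - rewrite [RHS](reindex e)/=; last exact: onW_bij.
    by apply: eq_bigr => i _; rewrite eK.
have GS : G @^-1` S = @std_simplex R d.
  by rewrite SE -comp_preimage (_ : G' \o G = id)//; apply/funext => u; exact: GK.
have mS : measurable S.
  rewrite SE -[X in measurable X]setTI.
  apply: (@measurableT_comp _ _ _ _ _ _ (tmulmx (invmx B))) => //.
  - exact: measurable_tmulmx.
  - exact: measurable_tshift.
  - exact: measurable_std_simplex.
split => //.
have [_ /(_ S mS)] := scales_comp (scales_tmulmx dB) (scales_tshift t0).
rewrite mulr1 -/G GS => <-.
by rewrite dE normrM mulrC EFinM muleA.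
Qed.

(** A barycentric coordinate is a linear form in the coordinates of the point,
    read off the inverse of [coord_mx g].  It takes the value 1 at a vertex, so
    it does not vanish on the whole hyperplane and its zeros have volume 0 in
    the chart. *)
Lemma null_face (g : I -> E) (k : I) : (forall k, unit_sum (g k)) ->
  \det (coord_mx g) != 0 ->
  exists N : set (d.-tuple T), [/\ measurable N, lam d N = 0 &
    forall t c, affine_map o b t = \sum_k c k *: g k -> c k = 0 -> N t].
Proof.
move=> gA dg; have [e' eK e'K] := e_bij.
pose q := invmx (coord_mx g).
pose L (x : E) := \sum_j x (e j) * q j (e' k).
have uM : coord_mx g \in unitmx by rewrite unitmxE unitfE.
have LE c : L (\sum_k c k *: g k) = c k.
  pose cr : 'rV[R]_d.+1 := \row_i c (e i).
  have crE : coord_row (\sum_k c k *: g k) = cr *m coord_mx g.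
    apply/rowP => j; rewrite !mxE sum_ffunE (reindex e)/=; last exact: onW_bij.
    by apply: eq_bigr => i _; rewrite !mxE ffunE.
  have := congr1 (fun v => (v *m q) 0 (e' k)) crE.
  rewrite mulmxK// !mxE e'K => <-; apply: eq_bigr => j _; congr (_ * _).
  by rewrite mxE.
have Lmap t : L (affine_map o b t) = L o + \sum_i tnth t i * L (b i).
  rewrite /L /affine_map; under eq_bigr do rewrite ffunE sum_ffunE mulrDl.
  rewrite big_split/=; congr (_ + _).
  under eq_bigr do rewrite mulr_suml.
  rewrite exchange_big; apply: eq_bigr => i _ /=; rewrite mulr_sumr.
  by apply: eq_bigr => j _; rewrite ffunE /= mulrA.
exists [set t | L o + \sum_i tnth t i * L (b i) = 0]; split.
- exact: measurable_hyperplane.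
- have [[i Li]|noL] := pselect (exists i, L (b i) != 0).
    by apply: hyperplane_null; exists i.
  have Lb i : L (b i) = 0 by apply/eqP; apply: contra_notT noL => ?; exists i.
  have [t _ tE] : range (affine_map o b) (g k) by rewrite (proj2 chart).
  have := Lmap t; rewrite tE big1; last by move=> i _; rewrite Lb mulr0.
  have -> : g k = \sum_j (j == k)%:R *: g j.
    rewrite (bigD1 k)//= eqxx scale1r big1 ?addr0// => j /negbTE ->.
    by rewrite scale0r.
  rewrite LE eqxx addr0 => /esym Lo; rewrite -(measure0 (lam d)); congr lebesgue_tuple.
  apply/seteqP; split => // t' /=; rewrite Lo big1 ?addr0; first by move/eqP; rewrite oner_eq0.
  by move=> i _; rewrite Lb mulr0.
- by move=> t c tE ck /=; rewrite -Lmap tE LE.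
Qed.

End Chart.
End Charts.

(** * Unimodular simplices and triangulations *)

Section FiniteUnions.
Context d (T : measurableType d) (R : realType) (mu : {measure set T -> \bar R}).

Lemma null_fin_bigcup (J : finType) (N : J -> set T) :
  (forall j, measurable (N j) /\ mu (N j) = 0) ->
  exists M : set T, [/\ measurable M, mu M = 0 & forall j, N j `<=` M].
Proof.
move=> N0; exists (\big[setU/set0]_j N j).
have [mM M0] : measurable (\big[setU/set0]_j N j) /\ mu (\big[setU/set0]_j N j) = 0.
  elim/big_ind: _ => [|A B [mA A0] [mB B0]|j _]; [by rewrite measure0| |exact: N0].
  by split; [exact: measurableU|rewrite measureU0].
split=> // j; rewrite -bigcup_seq; apply: bigcup_sup => /=; exact: mem_index_enum.
Qed.

(** Removing [N] makes the sets disjoint and does not change any measure. *)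
Lemma measure_fin_bigcup_null (J : finType) (F : J -> set T) (N : set T) :
  (forall j, measurable (F j)) -> measurable N -> mu N = 0 ->
  (forall i j, i != j -> F i `&` F j `<=` N) ->
  mu (\bigcup_j F j) = (\sum_j mu (F j))%E.
Proof.
move=> mF mN N0 FN.
have muD A : measurable A -> mu A = mu (A `\` N).
  move=> mA; transitivity (mu (A `|` N)); first by rewrite measureU0.
  rewrite -[RHS](measureU0 _ mN N0); last exact: measurableD.
  congr (mu _); apply/seteqP; split=> x [Ax|Nx]; try by right.
    by have [Nx|nNx] := pselect (N x); [right|left].
  by left; case: Ax.
rewrite muD; last by apply: fin_bigcup_measurable.
rewrite setD_bigcupl measure_fin_bigcup//; last 3 first.
- exact: finite_finset.
- apply/trivIsetP => i j _ _ ij; rewrite -subset0 => x [[Fi Nx] [Fj _]].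
  by apply: Nx; apply: (FN _ _ ij).
- by move=> j _; exact: measurableD.
under [RHS]eq_bigr do rewrite muD//.
have -> : [set: J] = [set` index_enum J].
  by apply/esym; rewrite -subTset => j _ /=; exact: mem_index_enum.
by rewrite [RHS]fsbig_seq ?index_enum_uniq.
Qed.

End FiniteUnions.

Section Triangulation.
Context {R : realType} {I : finType}.
Local Notation T := (measurableTypeR R).
Local Notation E := {ffun I -> R^o}.
Local Notation lam d := (@lebesgue_tuple R d).
Local Notation unit_sum := (@unit_sum R I).

Lemma unit_vecE (x : E) : x = \sum_k x k *: unit_vec R k.
Proof.
apply/ffunP => l; rewrite sum_ffunE (bigD1 l)//= !ffunE eqxx [_ *: _]mulr1.
rewrite big1 ?addr0// => k kl; rewrite !ffunE eq_sym (negbTE kl).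
by rewrite [LHS]mulr0.
Qed.

Lemma unit_vec_unit_sum k : unit_sum (unit_vec R k).
Proof.
rewrite /unit_sum /= (bigD1 k)//= ffunE eqxx big1 ?addr0// => l lk.
by rewrite ffunE (negbTE lk).
Qed.

Lemma unit_vec_lattice k : @lattice_points R I (unit_vec R k).
Proof. by move=> l; rewrite ffunE; case: eqP. Qed.

Lemma unimodular_mem (A : set E) m (w : 'I_m -> E) i : unimodular A w ->
  (lattice_points `&` A) (w i).
Proof.
move=> [_ ->]; exists (fun j => (j == i)%:R); split.
  by rewrite (bigD1 i)//= eqxx big1 ?addr0// => j /negbTE ->.
rewrite (bigD1 i)//= eqxx scale1r big1 ?addr0// => j /negbTE ->.
by rewrite scale0r.
Qed.

Lemma ord_bijection N : #|I| = N -> exists e : 'I_N -> I, bijective e.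
Proof.
move=> cI; exists (enum_val \o cast_ord (esym cI)).
apply: bij_comp; first exact: enum_val_bij.
by exists (cast_ord cI); [exact: cast_ordKV|exact: cast_ordK].
Qed.

(** The coordinates of the vertices [w] and the integer coefficients that
    express the unit vectors in [w] form mutually inverse rectangular matrices,
    so the matrices are square.  That both products are identities uses affine
    independence; affine dependences and linear ones are the same here, because
    all points have coordinate sum 1. *)
Lemma unimodular_card d (w : 'I_d.+1 -> E) : unimodular unit_sum w ->
  #|I| = d.+1.
Proof.
move=> uw; have [ind wE] := uw.
have wA i : unit_sum (w i) by have [] := unimodular_mem i uw.
have /choice[z zE] : forall k, exists c : 'I_d.+1 -> int,
    unit_vec R k = \sum_i (c i)%:~R *: w i.
  move=> k; have : (lattice_points `&` unit_sum) (unit_vec R k).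
    by split; [exact: unit_vec_lattice|exact: unit_vec_unit_sum].
  by rewrite wE => -[c [_ ->]]; exists c.
pose W : 'M[R]_(d.+1, #|I|) := \matrix_(i, k) w i (enum_val k).
pose V : 'M[R]_(#|I|, d.+1) := \matrix_(k, i) (z (enum_val k) i)%:~R.
have VW : V *m W = 1%:M.
  apply/matrixP => k l; rewrite !mxE.
  have := congr1 (fun x : E => x (enum_val l)) (zE (enum_val k)).
  rewrite /= ffunE (inj_eq enum_val_inj) eq_sym => ->.
  by rewrite sum_ffunE; apply: eq_bigr => i _; rewrite !mxE ffunE.
(* Linear independence: summing coordinates turns a linear relation between
   the vertices into an affine one. *)
have W_free (u : 'rV_d.+1) : u *m W = 0 -> u = 0.
  move=> uW; have u0 : \sum_i u 0 i *: w i = 0.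
    apply/ffunP => k; have := congr1 (fun v : 'rV_#|I| => v 0 (enum_rank k)) uW.
    rewrite !mxE => uk; rewrite sum_ffunE [RHS]ffunE -[RHS]uk.
    by apply: eq_bigr => i _; rewrite !mxE ffunE enum_rankK.
  apply/rowP => i; rewrite [RHS]mxE; apply: (ind (fun i => u 0 i)) => //.
  rewrite -(unit_sum_comb _ wA) u0 big1// => k _; exact: ffunE.
have WV : W *m V = 1%:M.
  apply/eqP; rewrite -subr_eq0; apply/eqP/row_matrixP => i; rewrite row0.
  apply: W_free; rewrite -row_mul mulmxBl -mulmxA VW mulmx1 mul1mx subrr.
  exact: row0.
by apply/eqP; rewrite eqn_leq (mulmx1_min VW) (mulmx1_min WV).
Qed.

Definition zspan (g : I -> E) : set E :=
  [set x | exists z : I -> int, x = \sum_j (z j)%:~R *: g j].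

Lemma zspan_mem (g : I -> E) k : zspan g (g k).
Proof.
exists (fun j => (j == k)%:R); rewrite (bigD1 k)//= eqxx scale1r.
by rewrite big1 ?addr0// => j /negbTE ->; rewrite scale0r.
Qed.

Lemma zspanD (g : I -> E) x y : zspan g x -> zspan g y -> zspan g (x + y).
Proof.
move=> [z ->] [z' ->]; exists (fun j => z j + z' j); rewrite -big_split/=.
by apply: eq_bigr => j _; rewrite rmorphD scalerDl.
Qed.

Lemma zspanN (g : I -> E) x : zspan g x -> zspan g (- x).
Proof.
move=> [z ->]; exists (fun j => - z j); rewrite -sumrN.
by apply: eq_bigr => j _; rewrite rmorphN scaleNr.
Qed.

Lemma zspan_unit_vec (x : E) : lattice_points x -> zspan (@unit_vec R I) x.
Proof.
move=> xZ; have /choice[z zE] : forall k, exists z : int, x k = z%:~R.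
  by move=> k; apply/intrP; exact: xZ.
by exists z; rewrite [LHS]unit_vecE; apply: eq_bigr => k _; rewrite zE.
Qed.

Section ZSpanDet.
Variables (d : nat) (e : 'I_d.+1 -> I).
Hypothesis e_bij : bijective e.

Lemma zspan_coord_mx (g g' : I -> E) : (forall k, zspan g (g' k)) ->
  exists2 Z : 'M[R]_d.+1, \det Z \is a Num.int &
    coord_mx e g' = Z *m coord_mx e g.
Proof.
move=> /choice[z zE]; exists (\matrix_(i, j) (z (e i) (e j))%:~R).
  by apply: det_int => i j; rewrite mxE.
apply/matrixP => i j; rewrite !mxE zE sum_ffunE (reindex e)/=; last exact: onW_bij.
by apply: eq_bigr => k _; rewrite !mxE ffunE.
Qed.

(** Families with the same integer span are related by integer matrices [Z] and
    [Z'] in both directions.  Either the determinant of the family vanishes, or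
    [det Z * det Z' = 1] with both factors integers. *)
Lemma norm_det_zspan (g g' : I -> E) :
  (forall k, zspan g (g' k)) -> (forall k, zspan g' (g k)) ->
  `|\det (coord_mx e g)| = `|\det (coord_mx e g')|.
Proof.
move=> /zspan_coord_mx[Z' Z'Z /(congr1 determinant)].
rewrite det_mulmx => g'E /zspan_coord_mx[Z ZZ /(congr1 determinant)].
rewrite det_mulmx => gE; have [g0|g0] := eqVneq (\det (coord_mx e g)) 0.
  by rewrite g'E g0 mulr0.
have ZZ'1 : \det Z' * \det Z = 1.
  by apply: (mulIf g0); rewrite mul1r {2}gE g'E; ring.
by rewrite g'E normrM (norm_int_unit Z'Z ZZ ZZ'1) mul1r.
Qed.

Lemma coord_mx_unit_vec : coord_mx e (@unit_vec R I) = 1%:M.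
Proof. by apply/matrixP => i j; rewrite !mxE ffunE (bij_eq e_bij) eq_sym. Qed.

Lemma lattice_basis_det (g : I -> E) : (forall k, lattice_points (g k)) ->
  (forall k, zspan g (unit_vec R k)) -> `|\det (coord_mx e g)| = 1.
Proof.
move=> gZ gu; rewrite -[RHS]normr1 -(det1 R d.+1) -coord_mx_unit_vec.
by apply: norm_det_zspan => // k; exact: zspan_unit_vec.
Qed.

Lemma det_coord_mxZ (s : I -> R) (g : I -> E) :
  \det (coord_mx e (fun k => s k *: g k)) =
  (\prod_k s k) * \det (coord_mx e g).
Proof.
have -> : coord_mx e (fun k => s k *: g k) =
    diag_mx (\row_i s (e i)) *m coord_mx e g.
  by apply/matrixP => i j; rewrite mul_diag_mx !mxE ffunE.
rewrite det_mulmx det_diag; congr (_ * _).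
rewrite [RHS](reindex e)/=; last exact: onW_bij.
by apply: eq_bigr => i _; rewrite mxE.
Qed.

End ZSpanDet.

Lemma unimodular_det d (e : 'I_d.+1 -> I) (w : 'I_d.+1 -> E) e' :
  cancel e e' -> cancel e' e -> unimodular unit_sum w ->
  `|\det (coord_mx e (w \o e'))| = 1.
Proof.
move=> eK e'K uw; have [_ wE] := uw; have eb : bijective e by exists e'.
apply: lattice_basis_det => // [k|k]; first by have [] := unimodular_mem (e' k) uw.
have : (lattice_points `&` unit_sum) (unit_vec R k).
  by split; [exact: unit_vec_lattice|exact: unit_vec_unit_sum].
rewrite wE => -[c [_ ->]]; exists (c \o e').
rewrite [RHS](reindex e)/=; last exact: onW_bij.
by apply: eq_bigr => i _; rewrite /= eK.
Qed.

(** The unit vectors are the vertices of a unimodular simplex, and its edges at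
    one vertex give a chart. *)
Lemma unimodular_chart_exists : (0 < #|I|)%N ->
  exists (d : nat) (o : E) (b : 'I_d -> E) (w : 'I_d.+1 -> E),
    affine_chart unit_sum o b /\ unimodular unit_sum w.
Proof.
case cI: #|I| => [//|d] _.
have [e eb] := ord_bijection cI.
have [e' eK e'K] := eb.
have ei := bij_eq eb.
pose org : E := unit_vec R (e ord0).
pose b i : E := unit_vec R (e (lift ord0 i)) - unit_vec R (e ord0).
have map_lift t k : affine_map org b t (e (lift ord0 k)) = tnth t k.
  rewrite /affine_map ffunE sum_ffunE [org _]ffunE ei add0r (bigD1 k)//= !ffunE !ei.
  rewrite eqxx subr0 [_ *: 1]mulr1 big1 ?addr0// => i ik; rewrite !ffunE !ei.
  by rewrite (inj_eq lift_inj) eq_sym (negbTE ik) subr0 scaler0.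
have map_0 t : affine_map org b t (e ord0) = 1 - \sum_i tnth t i.
  rewrite /affine_map ffunE sum_ffunE [org _]ffunE eqxx -sumrN; congr (_ + _).
  by apply: eq_bigr => i _; rewrite !ffunE !ei sub0r [LHS]mulrN1.
exists d, org, b, (fun i => unit_vec R (e i)); split; split.
- move=> t u tu; apply: eq_from_tnth => i.
  by rewrite -map_lift tu map_lift.
- apply/seteqP; split => [_ [t _ <-]|x x1].
    rewrite /unit_sum /= (reindex e)/=; last exact: onW_bij.
    rewrite big_ord_recl; under eq_bigr do rewrite map_lift.
    by rewrite map_0 subrK.
  exists [tuple x (e (lift ord0 i)) | i < d] => //.
  apply/ffunP => k; rewrite -[k]e'K; case: (unliftP ord0 (e' k)) => [j|] ->.
    by rewrite map_lift tnth_mktuple.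
  rewrite map_0; under eq_bigr do rewrite tnth_mktuple.
  move: x1; rewrite /unit_sum /= (reindex e)/=; last exact: onW_bij.
  by rewrite big_ord_recl => <-; rewrite addrK.
- move=> c _ c0 i; have := congr1 (fun x : E => x (e i)) c0.
  rewrite sum_ffunE [RHS]ffunE => <-; rewrite (bigD1 i)//= !ffunE eqxx [_ *: _]mulr1.
  rewrite big1 ?addr0// => j ji; rewrite !ffunE ei eq_sym (negbTE ji).
  by rewrite scaler0.
apply/seteqP; split => x /=.
  move=> [xZ x1]; have /choice[c cE] : forall i, exists c : int, x (e i) = c%:~R.
    by move=> i; apply/intrP; exact: xZ.
  exists c; split.
    apply/eqP; rewrite -(eqr_int R) rmorph_sum /=; apply/eqP.
    transitivity (\sum_k x k); last by rewrite x1.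
    rewrite [RHS](reindex e)/=; last exact: onW_bij.
    by apply: eq_bigr => i _; rewrite cE.
  rewrite [LHS]unit_vecE (reindex e)/=; last exact: onW_bij.
  by apply: eq_bigr => i _; rewrite cE.
move=> [c [c1 ->]]; split.
  move=> k; rewrite sum_ffunE; apply: rpred_sum => i _; rewrite !ffunE.
  by apply: rpredM; [exact: rpred_int|exact: rpred_nat].
rewrite /unit_sum /= unit_sum_comb; last by move=> j; exact: unit_vec_unit_sum.
by rewrite -(rmorph_sum (intmul (1 : R))) c1.
Qed.

(** Each simplex has [m] times the volume of the unimodular simplex [w], since
    both are compared with the standard simplex through the same chart.  A
    point common to two simplices lies on a facet of one of them, hence in a
    null set, and the volumes add up. *)
Theorem triangulated_volume (P : set E) (J : finType) (g : J -> I -> E) (m : R) :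
  (0 < #|I|)%N -> aff_hull P = unit_sum ->
  (forall s k, unit_sum (g s k)) -> m != 0 ->
  (forall s d (e : 'I_d.+1 -> I), bijective e ->
    `|\det (coord_mx e (g s))| = m) ->
  P = \bigcup_s conv_hull (range (g s)) ->
  (forall s s' c c', s != s' -> (forall k, 0 <= c k) -> (forall k, 0 <= c' k) ->
    \sum_k c k *: g s k = \sum_k c' k *: g s' k ->
    exists k, c k = 0 \/ c' k = 0) ->
  is_normalized_volume P (#|J|%:R * m).
Proof.
move=> I0 PA gA m0 dg PE overlap; rewrite /is_normalized_volume PA; split.
  exact: unimodular_chart_exists.
move=> d o b w chart uw; have cI := unimodular_card uw.
have [e eb] := ord_bijection cI.
have [e' eK e'K] := eb.
have wA i : unit_sum (w i) by have [] := unimodular_mem i uw.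
have rw : range w = range (w \o e').
  apply/seteqP; split => _ [i _ <-]; last by exists (e' i).
  by exists (e i) => //=; rewrite eK.
have dw := unimodular_det eK e'K uw.
have dw0 : \det (coord_mx e (w \o e')) != 0 by rewrite -normr_eq0 dw oner_eq0.
have dg0 s : \det (coord_mx e (g s)) != 0 by rewrite -normr_eq0 dg.
have [dc mw lw] := simplex_volume chart eb (fun k => wA (e' k)) dw0.
rewrite -rw dw mul1e in mw lw.
pose F s : set (d.-tuple T) := affine_map o b @^-1` conv_hull (range (g s)).
have vF s : measurable (F s) /\
    (`|\det (chart_mx o b e)|%:E * lam d (F s) = m%:E * lam d (@std_simplex R d))%E.
  have [_ mF lF] := simplex_volume chart eb (gA s) (dg0 s).
  by split => //; rewrite lF dg.
have [N [mN N0 FN]] : exists N : set (d.-tuple T), [/\ measurable N, lam d N = 0 &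
    forall s s', s != s' -> F s `&` F s' `<=` N].
  have /choice[N NP] : forall p : J * I, exists N : set (d.-tuple T),
      [/\ measurable N, lam d N = 0 &
      forall t c, affine_map o b t = \sum_k c k *: g p.1 k -> c p.2 = 0 -> N t].
    by move=> [s k]; apply: (null_face (e := e) chart eb k (gA s) (dg0 s)).
  have [M [mM M0 NM]] := @null_fin_bigcup _ _ _ (lam d) _ N
    (fun p => let: And3 mN N0 _ := NP p in conj mN N0).
  exists M; split => // s s' ss' t; rewrite /F !conv_hull_range.
  move=> [[c [c0 c1 tE]] [c' [c'0 c'1 t'E]]].
  have [k [ck|ck]] := overlap s s' c c' ss' c0 c'0 (etrans (esym tE) t'E).
    by apply: (NM (s, k)); have [_ _] := NP (s, k); apply; [exact: tE|].
  by apply: (NM (s', k)); have [_ _] := NP (s', k); apply; [exact: t'E|].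
have PF : affine_map o b @^-1` P = \bigcup_s F s by rewrite PE preimage_bigcup.
have lP := measure_fin_bigcup_null (fun s => proj1 (vF s)) mN N0 FN.
set k := `|\det (chart_mx o b e)| in lw vF.
have k0 : k != 0 by rewrite normr_eq0.
set D := fine (lam d (@std_simplex R d)).
have DE : lam d (@std_simplex R d) = D%:E.
  by rewrite fineK// lebesgue_std_simplex_fin_num.
have D0 : D != 0.
  by rewrite gt_eqF// -lte_fin -DE lebesgue_std_simplex_gt0.
have solve (x : \bar R) (r : R) : (k%:E * x = r%:E -> x = (r / k)%:E)%E.
  by move=> kx; rewrite mulrC EFinM -kx muleA -EFinM mulVf// mul1e.
exists (k / D); split.
  rewrite (solve (lam d (affine_map o b @^-1` conv_hull (range w))) D); last first.
    by rewrite -DE.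
  by rewrite -EFinM mulrA divfK// divff.
rewrite PF [lebesgue_tuple _]lP.
rewrite (eq_bigr (fun=> (m * D / k)%:E)); last first.
  by move=> s _; apply: solve; rewrite (proj2 (vF s)) DE EFinM.
rewrite sumEFin sumr_const -EFinM; congr EFin.
rewrite -mulr_natl; have -> : #|xpredT : pred J| = #|J| by apply: eq_card.
by field; rewrite k0 D0.
Qed.
End Triangulation.

(** * The cosmological polytope of a cycle *)

(** Every point of the cycle is an iterated successor of [i]: [j] is
    [i + (j + (n - i))] modulo [n]. *)
Lemma ordS_ind n (Q : 'I_n -> Prop) (i : 'I_n) :
  Q i -> (forall j, Q j -> Q (ordS j)) -> forall j, Q j.
Proof.
move=> Qi QS j; have n0 : (0 < n)%N by apply: leq_ltn_trans (ltn_ord i).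
have iterE k : val (iter k (@ordS n) i) = ((i + k) %% n)%N.
  elim: k => [|k IHk]; first by rewrite addn0 modn_small.
  by rewrite iterS /= IHk -addn1 modnDml addn1 addnS.
have Qiter k : Q (iter k (@ordS n) i) by elim: k => //= k; exact: QS.
have -> : j = iter (j + (n - i)) (@ordS n) i; last exact: Qiter.
apply: val_inj; rewrite iterE addnCA subnKC ?modnDr ?modn_small//.
exact: ltnW.
Qed.

Section Cycle.
Context {R : realType} (n : nat).
Local Notation I := ('I_n + 'I_n)%type.
Local Notation E := {ffun I -> R^o}.
Local Notation uv := (@unit_vec R I).
Implicit Types (a b c p : 'I_n -> R) (i j : 'I_n) (x : E) (S : {set 'I_n}).

(** The three generators of edge [i], named by the coordinate with the negative
    sign: the edge itself, its end [i + 1], or its end [i]. *)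
Definition genA i : E := uv (inl i) + uv (inl (ordS i)) - uv (inr i).
Definition genB i : E := uv (inl i) - uv (inl (ordS i)) + uv (inr i).
Definition genC i : E := - uv (inl i) + uv (inl (ordS i)) + uv (inr i).

Definition comb a b c : E :=
  \sum_i (a i *: genA i + b i *: genB i + c i *: genC i).

Lemma combE a b c : comb a b c =
  \sum_i (a i + b i - c i) *: uv (inl i) +
  \sum_i (a i - b i + c i) *: uv (inl (ordS i)) +
  \sum_i (- a i + b i + c i) *: uv (inr i).
Proof.
rewrite /comb -!big_split/=; apply: eq_bigr => i _.
apply/ffunP => k; rewrite !ffunE /GRing.scale /=; ring.
Qed.

Lemma comb_inr a b c i : comb a b c (inr i) = - a i + b i + c i.
Proof.
rewrite combE !ffunE !sum_ffunE big1 ?add0r => [|j _]; last first.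
  by rewrite !ffunE scaler0.
rewrite big1 ?add0r => [|j _]; last by rewrite !ffunE scaler0.
rewrite (bigD1 i)//= !ffunE eqxx big1 ?addr0 => [|j ji]; first exact: mulr1.
by rewrite !ffunE /= eq_sym [_ == _](negbTE ji) scaler0.
Qed.

Lemma comb_inl a b c i : comb a b c (inl (ordS i)) =
  (a (ordS i) + b (ordS i) - c (ordS i)) + (a i - b i + c i).
Proof.
rewrite combE !ffunE !sum_ffunE [X in _ + X]big1 ?addr0 => [|j _]; last first.
  by rewrite !ffunE scaler0.
congr (_ + _).
  rewrite (bigD1 (ordS i))//= !ffunE eqxx big1 ?addr0 => [|j ji]; first exact: mulr1.
  by rewrite !ffunE /= eq_sym [_ == _](negbTE ji) scaler0.
rewrite (bigD1 i)//= !ffunE eqxx big1 ?addr0 => [|j ji]; first exact: mulr1.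
by rewrite !ffunE /= [_ == _](inj_eq (@ordS_inj n)) eq_sym (negbTE ji) scaler0.
Qed.

Lemma ffun_cycle_eq (x y : E) : (forall i, x (inl (ordS i)) = y (inl (ordS i))) ->
  (forall i, x (inr i) = y (inr i)) -> x = y.
Proof.
move=> xyl xyr; apply/ffunP => -[i|i]; last exact: xyr.
by rewrite -[i](@ord_predK n).
Qed.

Lemma comb_sum a b c : \sum_k comb a b c k = \sum_i (a i + b i + c i).
Proof.
rewrite big_sumType /= (reindex (@ordS n))/=; last exact/onW_bij/ordS_bij.
under eq_bigr do rewrite comb_inl.
under [X in _ + X]eq_bigr do rewrite comb_inr.
rewrite big_split/=.
have -> : \sum_i (a (ordS i) + b (ordS i) - c (ordS i)) = \sum_i (a i + b i - c i).
  by rewrite [RHS](reindex (@ordS n))//=; exact/onW_bij/ordS_bij.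
rewrite -!big_split/=; apply: eq_bigr => i _; ring.
Qed.

(** The points of a cell are the combinations whose weights [a], [b] satisfy
    [a i = 0] off [S] and [b i = 0] on [S]. *)
Definition cell S (k : I) : E :=
  match k with
  | inl i => genC i
  | inr i => if i \in S then genA i else genB i
  end.

Lemma cell_comb S (c : I -> R) : \sum_k c k *: cell S k =
  comb (fun i => if i \in S then c (inr i) else 0)
       (fun i => if i \in S then 0 else c (inr i)) (c \o inl).
Proof.
rewrite big_sumType /= -big_split/=; apply: eq_bigr => i _ /=.
by case: ifP => _; rewrite scale0r ?addr0 ?add0r addrC.
Qed.

(** Write a point as a combination of the generators with weights [a], [b], [c],
    and let [p i = a i + b i - c i] be the part of the coordinate of vertex [i]
    that comes from edge [i]; the rest comes from edge [i - 1].  The point and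
    [p] determine the weights, and nonnegativity of the weights becomes a system
    of bounds on [p i] and on the differences [p (ordS i) - p i]. *)
Definition feasible x p := forall i, [/\ 0 <= p i + x (inr i),
  0 <= x (inl (ordS i)) - p (ordS i) + x (inr i) &
  0 <= p i + (x (inl (ordS i)) - p (ordS i))].

Definition weightA x p i := (p i + (x (inl (ordS i)) - p (ordS i))) / 2.
Definition weightB x p i := (p i + x (inr i)) / 2.
Definition weightC x p i := (x (inl (ordS i)) - p (ordS i) + x (inr i)) / 2.

Lemma comb_weight x p : comb (weightA x p) (weightB x p) (weightC x p) = x.
Proof.
by apply: ffun_cycle_eq => i; rewrite ?comb_inl ?comb_inr /weightA /weightB /weightC; field.
Qed.

Lemma feasible_weight x p : feasible x p ->
  forall i, [/\ 0 <= weightA x p i, 0 <= weightB x p i & 0 <= weightC x p i].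
Proof. by move=> xp i; have [? ? ?] := xp i; split; apply: divr_ge0. Qed.

Lemma feasible_comb a b c : (forall i, 0 <= a i) -> (forall i, 0 <= b i) ->
  (forall i, 0 <= c i) -> feasible (comb a b c) (fun i => a i + b i - c i).
Proof.
move=> a0 b0 c0 i; rewrite comb_inl comb_inr.
by move: (a0 i) (b0 i) (c0 i) => ? ? ?; split; lra.
Qed.

(** Bounds on variables and on differences of two variables are stable under
    pointwise infima, and [p i] is bounded below by minus the edge coordinate. *)
Lemma feasible_least x p0 : feasible x p0 ->
  exists2 q, feasible x q & forall p, feasible x p -> forall i, q i <= p i.
Proof.
move=> xp0; pose V i := [set r : R | exists2 p, feasible x p & r = p i].
have V0 i : V i !=set0 by exists (p0 i), p0.
have Vlb i : has_lbound (V i).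
  exists (- x (inr i)) => _ [p xp ->]; have [] := xp i; lra.
have qle p : feasible x p -> forall i, inf (V i) <= p i.
  by move=> xp i; apply: ge_inf => //; exists p.
exists (fun i => inf (V i)) => // i; split.
- rewrite -lerBlDr sub0r; apply: lb_le_inf => // _ [p xp ->].
  by have [] := xp i; lra.
- by have := qle _ xp0 (ordS i); have [] := xp0 i; lra.
- suff : inf (V (ordS i)) - x (inl (ordS i)) <= inf (V i) by lra.
  apply: lb_le_inf => // _ [p xp ->].
  by have := qle _ xp (ordS i); have [] := xp i; lra.
Qed.

(** Otherwise both lower bounds on [q i] are slack and [q i] alone can be
    decreased a little; no other constraint loses slack. *)
Lemma least_tight x q : feasible x q ->
  (forall p, feasible x p -> forall i, q i <= p i) ->
  forall i, weightA x q i = 0 \/ weightB x q i = 0.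
Proof.
move=> xq q_min i; have [a0 b0 _] := feasible_weight xq i.
have [->|a_neq0] := eqVneq (weightA x q i) 0; first by left.
have [->|b_neq0] := eqVneq (weightB x q i) 0; first by right.
(* Half the smaller of the two slacks. *)
pose eps := Num.min (weightA x q i) (weightB x q i).
have eps_gt0 : 0 < eps by rewrite lt_min !lt_neqAle eq_sym a_neq0 a0 eq_sym b_neq0.
have epsA : eps <= weightA x q i by rewrite ge_min lexx.
have epsB : eps <= weightB x q i by rewrite ge_min lexx orbT.
pose p j := if j == i then q j - eps else q j.
have p_le j : p j <= q j by rewrite /p; case: eqP => // _; rewrite gerBl ltW.
suff /q_min/(_ i) : feasible x p by rewrite /p eqxx; lra.
move=> j; have [? ? ?] := xq j; have := p_le (ordS j).
have [ji|ji] := eqVneq j i; last first.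
  have -> : p j = q j by rewrite /p (negbTE ji).
  by split; lra.
have -> : p j = q j - eps by rewrite /p ji eqxx.
by move: epsA epsB; rewrite /weightA /weightB -ji => ? ? ?; split; lra.
Qed.

(** Otherwise all [q i] can be decreased by the same amount, which leaves their
    differences unchanged. *)
Lemma least_tightB x q : (0 < n)%N -> feasible x q ->
  (forall p, feasible x p -> forall i, q i <= p i) ->
  exists i, weightB x q i = 0.
Proof.
move=> n0 xq q_min; pose i0 := Ordinal n0.
(* Half the smallest slack is a step that suits all indices. *)
have [i _ imin] := @Order.TotalTheory.arg_minP _ _ _ i0 xpredT (weightB x q) isT.
exists i; apply/eqP; apply: contraT => bi.
have bi0 : 0 < weightB x q i by rewrite lt_neqAle eq_sym bi; case: (feasible_weight xq i).
suff /q_min/(_ i) /= : feasible x (fun j => q j - weightB x q i) by lra.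
move=> j; have [? ? ?] := xq j; have := imin j isT.
by move: bi0; rewrite /weightB => ? ?; split; lra.
Qed.

(** If [p j > p' j], then [b j > 0], so [a j = 0] and [p j] equals
    [p (ordS j)] minus a vertex coordinate, whereas [p' j] is at least the
    corresponding expression.  Hence [p (ordS j) > p' (ordS j)], and going
    around the cycle [b j > 0] for all [j], contrary to the hypothesis. *)
Lemma tight_le a b c a' b' c' : (forall i, 0 <= a' i) -> (forall i, 0 <= b' i) ->
  (forall i, 0 <= b i) ->
  (forall i, b i != 0 -> a i = 0) -> (exists i, b i = 0) ->
  comb a b c = comb a' b' c' ->
  forall i, a i + b i - c i <= a' i + b' i - c' i.
Proof.
move=> a'0 b'0 b0 ab [i0 bi0] xx' i.
have step j : a' j + b' j - c' j < a j + b j - c j ->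
    b j != 0 /\ a' (ordS j) + b' (ordS j) - c' (ordS j) <
                a (ordS j) + b (ordS j) - c (ordS j).
  move=> ltj; have := congr1 (fun x : E => x (inr j)) xx'.
  have := congr1 (fun x : E => x (inl (ordS j))) xx'.
  rewrite /= !comb_inl !comb_inr => eql eqr.
  have := a'0 j; have := b'0 j => b'j a'j.
  have bj : b j != 0 by apply/eqP => bj; lra.
  by split => //; have := ab j bj; lra.
rewrite leNgt; apply/negP => lti.
have := @ordS_ind n (fun j => a' j + b' j - c' j < a j + b j - c j) i lti.
by move=> /(_ (fun j lj => proj2 (step j lj)) i0)/step[]; rewrite bi0 eqxx.
Qed.

Local Notation P := (cosmological_polytope R (cycle_graph n) : set E).

Definition gen (k : 'I_n + ('I_n + 'I_n)) : E :=
  match k with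
  | inl i => genA i
  | inr (inl i) => genB i
  | inr (inr i) => genC i
  end.

Lemma generators_cycle :
  @cosmological_generators R (cycle_graph n) = range gen.
Proof.
apply/seteqP; split => [x [i [->|->|->]]|_ [[i|[i|i]] _ <-]].
- by exists (inl i).
- by exists (inr (inl i)).
- by exists (inr (inr i)).
- by exists i; apply: Or31.
- by exists i; apply: Or32.
- by exists i; apply: Or33.
Qed.

Lemma gen_comb (c : 'I_n + ('I_n + 'I_n) -> R) : \sum_k c k *: gen k =
  comb (c \o inl) (c \o inr \o inl) (c \o inr \o inr).
Proof. by rewrite !big_sumType /= -!big_split /=; apply: eq_bigr => i _; rewrite addrA. Qed.

Lemma polytope_comb : P = [set x | exists a b c,
  [/\ forall i, [/\ 0 <= a i, 0 <= b i & 0 <= c i],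
      \sum_i (a i + b i + c i) = 1 & x = comb a b c]].
Proof.
rewrite /cosmological_polytope generators_cycle conv_hull_range.
apply/seteqP; split => x /=.
  move=> [f [f0 f1 ->]]; exists (f \o inl), (f \o inr \o inl), (f \o inr \o inr).
  split; [by move=> i; split; exact: f0| |exact: gen_comb].
  rewrite -f1 !big_sumType /= -!big_split /=.
  by apply: eq_bigr => i _; rewrite addrA.
move=> [a [b [c [abc0 s1 ->]]]].
exists (fun k => match k with
  | inl i => a i | inr (inl i) => b i | inr (inr i) => c i end).
split; last by rewrite gen_comb.
- by case=> [i|[i|i]]; have [] := abc0 i.
- rewrite -s1 !big_sumType /= -!big_split /=.
  by apply: eq_bigr => i _; rewrite addrA.
Qed.

Lemma comb_unit_inl i : uv (inl i) =
  comb (fun j => (j == i)%:R / 2) (fun j => (j == i)%:R / 2) (fun=> 0).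
Proof.
rewrite /comb (bigD1 i)//= eqxx big1 => [|j /negbTE ->].
  by apply/ffunP => k; rewrite !ffunE /GRing.scale /=; field.
by rewrite mul0r !scale0r !addr0.
Qed.

Lemma comb_unit_inr i : uv (inr i) =
  comb (fun=> 0) (fun j => (j == i)%:R / 2) (fun j => (j == i)%:R / 2).
Proof.
rewrite /comb (bigD1 i)//= eqxx big1 => [|j /negbTE ->].
  by apply/ffunP => k; rewrite !ffunE /GRing.scale /=; field.
by rewrite mul0r !scale0r !addr0.
Qed.

Lemma unit_vec_polytope k : P (uv k).
Proof.
have d0 (j i : 'I_n) : 0 <= (j == i)%:R / 2 :> R by rewrite divr_ge0.
have s1 i : \sum_j (j == i)%:R = 1 :> R.
  by rewrite (bigD1 i)//= eqxx big1 ?addr0// => j /negbTE ->.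
rewrite polytope_comb; case: k => i; do 3!eexists; split;
  [|  |exact: comb_unit_inl| | |exact: comb_unit_inr].
- by move=> j; split.
- by rewrite -[RHS](s1 i); apply: eq_bigr => j _; rewrite addr0 -mulrDr; field.
- by move=> j; split.
- by rewrite -[RHS](s1 i); apply: eq_bigr => j _; rewrite add0r; field.
Qed.

Lemma polytope_unit_sum : P `<=` unit_sum.
Proof. by rewrite polytope_comb => x [a [b [c [_ s1 ->]]]]; rewrite /unit_sum /= comb_sum. Qed.

Lemma aff_hull_polytope : aff_hull P = unit_sum.
Proof.
apply/seteqP; split => x /=.
  move=> [m [p [c [Pp c1 ->]]]]; rewrite /unit_sum /= unit_sum_comb//.
  by move=> j; exact: polytope_unit_sum.
move=> x1; pose J : finType := I.
exists #|J|, (uv \o @enum_val J J), (x \o @enum_val J J); split => //=.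
- by move=> i; exact: unit_vec_polytope.
- rewrite -[RHS]x1 [RHS](reindex (@enum_val J J))//=.
  by apply: onW_bij; exact: enum_val_bij.
- rewrite [LHS]unit_vecE [LHS](reindex (@enum_val J J))//=.
  by apply: onW_bij; exact: enum_val_bij.
Qed.

Lemma gen_unit_sum k : unit_sum (gen k).
Proof.
apply: polytope_unit_sum; rewrite /cosmological_polytope generators_cycle conv_hull_range.
exists (fun l => (l == k)%:R); split.
- by [].
- by rewrite (bigD1 k)//= eqxx big1 ?addr0// => l /negbTE ->.
- rewrite (bigD1 k)//= eqxx scale1r big1 ?addr0// => l /negbTE ->.
  by rewrite scale0r.
Qed.

Lemma cell_unit_sum S k : unit_sum (cell S k).
Proof.
case: k => i /=; first exact: (gen_unit_sum (inr (inr i))).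
by case: ifP => _; [exact: (gen_unit_sum (inl i))|exact: (gen_unit_sum (inr (inl i)))].
Qed.

(** The weights of the least feasible [q] have [a i = 0] or [b i = 0] for every
    [i], so the point lies in the cell of the set of edges where [b] vanishes,
    which is nonempty. *)
Lemma polytope_cells : (0 < n)%N ->
  P = \bigcup_(s : {S : {set 'I_n} | S != finset.set0})
    conv_hull (range (cell (val s))).
Proof.
move=> n0; rewrite polytope_comb; apply/seteqP; split => x.
  move=> [a [b [c [abc0 s1 ->]]]].
  have [q xq q_min] := feasible_least (feasible_comb
    (fun i => let: And3 h _ _ := abc0 i in h) (fun i => let: And3 _ h _ := abc0 i in h)
    (fun i => let: And3 _ _ h := abc0 i in h)).
  set y := comb a b c in xq q_min *.
  have tight := least_tight xq q_min.
  have [i0 bi0] := least_tightB n0 xq q_min.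
  pose S := [set i | weightB y q i == 0]%SET.
  have S0 : S != finset.set0 by apply/set0Pn; exists i0; rewrite inE bi0.
  exists (exist _ S S0) => //; rewrite conv_hull_range.
  pose f (k : I) := match k with
    | inl i => weightC y q i
    | inr i => if i \in S then weightA y q i else weightB y q i end.
  have fE : \sum_k f k *: cell S k = y.
    rewrite cell_comb -[RHS](comb_weight y q).
    congr comb; apply/funext => i; rewrite /f /=.
      case: ifP => [->//|]; rewrite inE => bi.
      by case: (tight i) => [->//|/eqP]; rewrite bi.
    by case: ifP => [|->//]; rewrite inE => /eqP ->.
  exists f; split => //.
    by case=> i /=; have [] := feasible_weight xq i => // ? ? ?; case: ifP.
  by rewrite -(unit_sum_comb f (cell_unit_sum S)) fE comb_sum.
move=> [[S S0] _]; rewrite conv_hull_range => -[f [f0 f1 ->]] /=.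
rewrite cell_comb; do 3!eexists; split; last reflexivity.
  by move=> i; split => /=; [case: ifP|case: ifP|].
by rewrite -comb_sum -cell_comb unit_sum_comb//; exact: cell_unit_sum.
Qed.

(** By [tight_le] in both directions, the two representations have the same
    weights.  At an edge that belongs to only one of [S] and [S'], the weight
    of [genA] vanishes by one representation and that of [genB] by the other. *)
Lemma cell_overlap S S' (c c' : I -> R) :
  S != finset.set0 -> S' != finset.set0 -> S != S' ->
  (forall k, 0 <= c k) -> (forall k, 0 <= c' k) ->
  \sum_k c k *: cell S k = \sum_k c' k *: cell S' k ->
  exists k, c k = 0.
Proof.
move=> /set0Pn[i0 Si0] /set0Pn[j0 Sj0] SS' c0 c'0; rewrite !cell_comb.
set a := fun i => _; set b := fun i => _; set c1 := _ \o _.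
set a' := fun i => _; set b' := fun i => _; set c1' := _ \o _ => eqx.
have a0 i : 0 <= a i by rewrite /a; case: ifP.
have b0 i : 0 <= b i by rewrite /b; case: ifP.
have a'0 i : 0 <= a' i by rewrite /a'; case: ifP.
have b'0 i : 0 <= b' i by rewrite /b'; case: ifP.
have ab i : b i != 0 -> a i = 0 by rewrite /a /b; case: ifP => //; rewrite eqxx.
have ab' i : b' i != 0 -> a' i = 0 by rewrite /a' /b'; case: ifP => //; rewrite eqxx.
have pp' i : a i + b i - c1 i = a' i + b' i - c1' i.
  apply: le_anti; rewrite (tight_le a'0 b'0 b0 ab _ eqx); last first.
    by exists i0; rewrite /b Si0.
  by rewrite (tight_le a0 b0 b'0 ab' _ (esym eqx))//; exists j0; rewrite /b' Sj0.
have [i] : exists i, (i \in S) != (i \in S').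
  by apply/existsP; apply: contraNT SS'; rewrite negb_exists => /forallP eqS;
    apply/eqP/setP => i; apply/eqP/negPn.
have := congr1 (fun x : E => x (inr i)) eqx.
have := congr1 (fun x : E => x (inl (ordS i))) eqx.
rewrite /= !comb_inl !comb_inr => eql eqr.
have ea : a i = a' i by have := pp' i; have := pp' (ordS i); lra.
have eb : b i = b' i by have := pp' i; have := pp' (ordS i); lra.
move=> iSS'; exists (inr i); move: iSS' ea eb; rewrite /a /b /a' /b'.
by case: (i \in S); case: (i \in S').
Qed.

(** In a cell, [genA i + genC i] is twice the unit vector of [ordS i], and
    [genB i + genC i] is twice that of the edge [i].  Replacing [genA i] and
    [genB i] by these halves yields a basis of the lattice if [S] is nonempty. *)
Definition half_cell S (k : I) : E :=
  match k with
  | inl i => genC i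
  | inr i => if i \in S then uv (inl (ordS i)) else uv (inr i)
  end.

Lemma gen_lattice k : lattice_points (gen k).
Proof.
by case: k => [i|[i|i]] k' /=; rewrite !ffunE;
  do ?[apply: rpredD|rewrite rpredN]; exact: rpred_nat.
Qed.

Lemma half_cell_lattice S k : lattice_points (half_cell S k).
Proof.
case: k => i /=; first exact: (gen_lattice (inr (inr i))).
by case: ifP => _; exact: unit_vec_lattice.
Qed.

(** For [i] in [S] the vector of vertex [i + 1] is in the family.  For [i] not
    in [S] the vector of the edge [i] is, and [genC i] then carries membership
    of vertex [i] to vertex [i + 1].  Starting from an element of [S], this
    reaches all vertices; the remaining edges follow from [genC]. *)
Lemma half_cell_zspan S k : S != finset.set0 -> zspan (half_cell S) (uv k).
Proof.
move=> /set0Pn[i0 Si0].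
have genC_in i : zspan (half_cell S) (genC i) := zspan_mem (half_cell S) (inl i).
have next i : zspan (half_cell S) (uv (inl (ordS i))).
  apply: (@ordS_ind n (fun i => zspan (half_cell S) (uv (inl (ordS i)))) i0).
    by have := zspan_mem (half_cell S) (inr i0); rewrite /= Si0.
  move=> j zj; have := zspan_mem (half_cell S) (inr (ordS j)) => /=.
  case: ifP => // _ ze.
  have -> : uv (inl (ordS (ordS j))) =
      genC (ordS j) + uv (inl (ordS j)) - uv (inr (ordS j)).
    by apply/ffunP => l; rewrite !ffunE; ring.
  by apply: zspanD (zspanN ze); exact: zspanD.
have all_inl i : zspan (half_cell S) (uv (inl i)).
  by have := next (ord_pred i); rewrite ord_predK.
case: k => [//|i].
have -> : uv (inr i) = genC i + uv (inl i) - uv (inl (ordS i)).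
  by apply/ffunP => l; rewrite !ffunE; ring.
by apply: zspanD (zspanN (next i)); exact: zspanD.
Qed.

(** Adding [genC i] to the other generator of edge [i] does not change the
    integer span, and produces twice an element of a lattice basis for each of
    the [n] edges. *)
Lemma cell_det S d (e : 'I_d.+1 -> I) : S != finset.set0 -> bijective e ->
  `|\det (coord_mx e (cell S))| = 2 ^+ n :> R.
Proof.
move=> S0 eb; pose s (k : I) : R := if k is inl _ then 1 else 2.
have -> : `|\det (coord_mx e (cell S))| =
    `|\det (coord_mx e (fun k => s k *: half_cell S k))|.
  have cellE i : s (inr i) *: half_cell S (inr i) = cell S (inr i) + genC i.
    by rewrite /=; case: ifP => _; apply/ffunP => l; rewrite !ffunE /GRing.scale /=; ring.
  apply: (norm_det_zspan eb) => -[i|i].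
  - by rewrite scale1r; exact: (zspan_mem (cell S) (inl i)).
  - rewrite cellE; apply: zspanD; first exact: zspan_mem.
    exact: (zspan_mem (cell S) (inl i)).
  - have := zspan_mem (fun k => s k *: half_cell S k) (inl i).
    by rewrite /= scale1r.
  - rewrite -[cell S (inr i)](addrK (genC i)) -cellE; apply: zspanD.
      exact: (zspan_mem (fun k => s k *: half_cell S k)).
    apply: zspanN; have := zspan_mem (fun k => s k *: half_cell S k) (inl i).
    by rewrite /= scale1r.
rewrite (det_coord_mxZ eb) normrM (lattice_basis_det eb); last 2 first.
- exact: half_cell_lattice.
- by move=> k; exact: half_cell_zspan.
by rewrite mulr1 big_sumType /= big1// mul1r prodr_const card_ord ger0_norm//.
Qed.

End Cycle.

Theorem theorem3 (R : realType) (n : nat) (hn : (0 < n)%N) :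
  is_normalized_volume (cosmological_polytope R (cycle_graph n))
    (4 ^+ n - 2 ^+ n).
Proof.
have -> : 4 ^+ n - 2 ^+ n = #|{: {S : {set 'I_n} | S != finset.set0}}|%:R *
    2 ^+ n :> R.
  rewrite card_sig (_ : #|_| = (2 ^ n - 1)%N); last first.
    have -> : (2 ^ n = #|{set 'I_n}|)%N
      by rewrite -cardsT -powersetT card_powerset cardsT card_ord.
    by rewrite (cardC1 finset.set0) subn1.
  rewrite natrB ?expn_gt0// natrX mulrBl mul1r -exprMn; congr (_ ^+ _ - _); ring.
apply: (triangulated_volume (I := ('I_n + 'I_n)%type)
  (g := fun s : {S : {set 'I_n} | S != finset.set0} => cell (val s))).
- by rewrite card_sum card_ord addn_gt0 hn.
- exact: aff_hull_polytope.
- by move=> s k; exact: cell_unit_sum.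
- by rewrite expf_neq0// pnatr_eq0.
- by move=> [S S0] d e eb; exact: cell_det.
- exact: polytope_cells.
- move=> s s' c c' ss' c0 c'0 eqx.
  have [k ck] := cell_overlap (valP s) (valP s') ss' c0 c'0 eqx.
  by exists k; left.
Qed.
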